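(* Let $K$ be an algebraically closed field of characteristic zero, $r\ge 2$, $d\in\mathbb N^*$, $\tilde\nu_0\in\mathbb N$, $p\in\mathbb N^*$, $q_1,\dots,q_{r-1}\in\mathbb N$. Put $\zeta_i:=\left(x_i/x_{i+1}^{q_i}\right)^{1/p}$ for $i=1,\dots,r-1$ and $\zeta_r:=x_r^{1/p}$. Let $\tilde f,\tilde g\in K[[\zeta_1,\dots,\zeta_r]]$ be nonzero and $\tilde y_0=\tilde f/\tilde g\in\mathcal K_r$. Assume that there is a nonzero polynomial $\tilde P(\underline x,y)\in K[[\underline x]][y]$ with $\tilde P(\underline x,\tilde y_0)=0$, $\deg_y\tilde P\le d$ and $(\underline x)$-adic order at most $\tilde\nu_0$. Let $\underline\beta=(\beta_1,\dots,\beta_r)$ be the lexicographic valuation of $\tilde f\tilde g$ with respect to the variables $\zeta_1,\dots,\zeta_r$, put $q_i':=q_i+\beta_{i+1}+1$ for $i=1,\dots,r-1$, and $$\tilde L:\mathbb Z^r\to\mathbb Z,\qquad \tilde L(n_1,\dots,n_r)=n_r+q'_{r-1}n_{r-1}+q'_{r-1}q'_{r-2}n_{r-2}+\cdots+q'_{r-1}q'_{r-2}\cdots q'_1\,n_1 .$$ For $\nu\in\mathbb N$ let $\mathcal Q_\nu$ be the set of all $\tilde Q_\nu\in K[[\underline x]][y]$ with $\deg_y\tilde Q_\nu\le d$ and $(\underline x)$-adic order at most $\tilde\nu_0$ such that $\tilde L(\underline n)\ge\nu$ for every $\frac1p\underline n\in\mathrm{Supp}\,\tilde Q_\nu(\underline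 x,\tilde y_0)$. Then there is an algorithm which, for every such data and every $\nu\in\mathbb N$, provides a parametric description of $\mathcal Q_\nu$. The input of the algorithm consists of $d,\tilde\nu_0,p,q_1,\dots,q_{r-1},\nu$, the lexicographic valuations of $\tilde f$ and $\tilde g$ with respect to $\underline\zeta$, and a procedure which for any $k\in\mathbb N$ returns all coefficients of $\underline\zeta^{\underline n}$ with $n_1+\cdots+n_r\le k$ in $\tilde f$ and $\tilde g$.
   Context: $\mathbb N=\mathbb Z_{\ge0}$, $\mathbb N^*=\mathbb N\setminus\{0\}$, $\underline x=(x_1,\dots,x_r)$, $\underline x^{\underline n}=x_1^{n_1}\cdots x_r^{n_r}$ and $|\underline i|=i_1+\cdots+i_r$. The field $\mathcal L_r$ is the union over $p\in\mathbb N^*$ of the fields $K((x_r^{1/p}))((x_{r-1}^{1/p}))\cdots((x_1^{1/p}))$ ($K$ being algebraically closed). Its elements are identified with generalized series $\sum_{\underline n\in\mathbb Z^r}c_{\underline n/p}\,\underline x^{\underline n/p}$ whose support $\mathrm{Supp}=\{\frac1p\underline n\mid c_{\underline n/p}\ne0\}\subset\frac1p\mathbb Z^r$ is well-ordered for the lexicographic order. $\mathcal K_r\subset\mathcal L_r$ is the union, over all $p\in\mathbb N^*$ and $(q_1,\dots,q_{r-1})\in\mathbb N^{r-1}$, of the fraction fields of the rings $K[[(x_1/x_2^{q_1})^{1/p},\dots,(x_{r-1}/x_r^{q_{r-1}})^{1/p},x_r^{1/p}]]$. $\mathrm{Supp}\,\tilde Q(\underline x,\tilde y_0)$ is the support of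 $\tilde Q(\underline x,\tilde y_0)\in\mathcal K_r$ expanded in this way. The lexicographic valuation of a nonzero series in the variables $\underline\zeta$ is the lexicographically smallest exponent of its support. The $(\underline x)$-adic order of a nonzero $\tilde Q\in K[[\underline x]][y]$ is the largest $k$ such that $\tilde Q\in(\underline x)^kK[[\underline x]][y]$, where $(\underline x)$ is the ideal of $K[[\underline x]]$ generated by $x_1,\dots,x_r$ (so polynomials of order at most $\tilde\nu_0$ are nonzero). Algorithms may use exact field operations and zero tests in $K$, and the given procedure for the coefficients of $\tilde f,\tilde g$. A parametric description of $\mathcal Q_\nu$ consists of an integer $N\ge\tilde\nu_0$ and finitely many $K$-linearly independent vectors $b_1,\dots,b_M\in K^{I_N}$, where $I_N=\{(\underline i,j)\mid \underline i\in\mathbb N^r,\ |\underline i|\le N,\ 0\le j\le d\}$, such that a polynomial $\tilde Q=\sum_{\underline i\in\mathbb N^r,\,0\le j\le d}a_{\underline i,j}\underline x^{\underline i}y^j$ belongs to $\mathcal Q_\nu$ if and only if $(a_{\underline i,j})_{(\underline i,j)\in I_N}=\sum_m\theta_mb_m$ for some $(\theta_1,\dots,\theta_M)\in K^M$ (the free parameters) and $a_{\underline i,j}\ne0$ for some $(\underline i,j)$ with $|\underline i|\le\tilde\nu_0$. The coefficients with index outside $I_N$ are unconstrained. *)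

(* Defs.v *)
From HB Require Import structures.
From mathcomp Require Import all_boot all_order all_algebra.
From mathcomp Require Import finmap boolp classical_sets functions cardinality fsbigop.
From mathcomp Require Import zify.
Set Implicit Arguments.
Unset Strict Implicit.
Unset Printing Implicit Defensive.
Import Order.TTheory GRing.Theory Num.Theory.
Local Open Scope ring_scope.

Record laurent (F : fieldType) := Laurent {
  lcoef :> int -> F;
  lcoef_bounded : exists m : int, forall n : int, n < m -> lcoef n = 0 }.

Section LaurentField.
Variable F : fieldType.
Implicit Types u v w : laurent F.

HB.instance Definition _ := gen_eqMixin (laurent F).
HB.instance Definition _ := gen_choiceMixin (laurent F).

Lemma laurentP u v : (forall n, u n = v n) -> u = v.
Proof.
case: u v => [u bu] [v bv] /= /funext uv; case: _ / uv in bv *.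
by congr Laurent; apply: Prop_irrelevance.
Qed.

Fact lconst_bounded (c : F) :
  exists m : int, forall n : int, n < m -> (if n == 0 then c else 0) = 0.
Proof. by exists 0 => n n0; rewrite lt_eqF. Qed.
Definition lconst (c : F) : laurent F := Laurent (lconst_bounded c).

Fact lX_bounded : exists m : int, forall n : int, n < m -> ((n == 1)%:R : F) = 0.
Proof. by exists 1 => n n0; rewrite lt_eqF. Qed.
Definition lX : laurent F := Laurent lX_bounded.

Fact lopp_bounded u : exists m : int, forall n : int, n < m -> - u n = 0.
Proof. by have [m um] := lcoef_bounded u; exists m => n /um->; rewrite oppr0. Qed.
Definition lopp u : laurent F := Laurent (lopp_bounded u).

Lemma lcoef_bounded2 u v :
  exists m : int, forall n : int, n < m -> u n = 0 /\ v n = 0.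
Proof.
have [m um] := lcoef_bounded u; have [m' vm] := lcoef_bounded v.
by exists (Order.min m m') => n; rewrite lt_min => /andP[/um-> /vm->].
Qed.

Fact ladd_bounded u v : exists m : int, forall n : int, n < m -> u n + v n = 0.
Proof.
by have [m uv] := lcoef_bounded2 u v; exists m => n /uv[-> ->]; rewrite addr0.
Qed.
Definition ladd u v : laurent F := Laurent (ladd_bounded u v).

(* The sum has finitely many nonzero terms, both supports being bounded below. *)
Definition lmul_coef u v (n : int) : F := \sum_(k \in [set: int]) u k * v (n - k).

Lemma lmul_coef0 u v (a b n : int) : (forall k, k < a -> u k = 0) ->
  (forall k, k < b -> v k = 0) -> n < a + b -> lmul_coef u v n = 0.
Proof.
move=> ua vb nab; apply: fsbig1 => k _; have [/ua->|ak] := ltP k a.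
  by rewrite mul0r.
by rewrite [v _]vb ?mulr0//; lia.
Qed.

Fact lmul_bounded u v : exists m : int, forall n : int, n < m -> lmul_coef u v n = 0.
Proof.
have [a ua] := lcoef_bounded u; have [b vb] := lcoef_bounded v.
by exists (a + b) => n; apply: lmul_coef0.
Qed.
Definition lmul u v : laurent F := Laurent (lmul_bounded u v).

Lemma lmulE u v (a b : int) (n : nat) : (forall k, k < a -> u k = 0) ->
  (forall k, k < b -> v k = 0) ->
  lmul u v (a + b + n%:Z) = \sum_(i < n.+1) u (a + i%:Z) * v (b + (n - i)%N%:Z).
Proof.
move=> ua vb; rewrite /= /lmul_coef.
set s := [seq a + i%:Z | i <- iota 0 n.+1].
have us : uniq s by rewrite map_inj_uniq ?iota_uniq// => i j; lia.
rewrite (fsbigE s)//; last first.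
  move=> k _ ks; have [/ua->|ak] := ltP k a; first by rewrite mul0r.
  rewrite [v _]vb ?mulr0//; case: (ltP (a + n%:Z) k) => [|kn]; first by lia.
  case/mapP: ks; exists (absz (k - a)%R); last by lia.
  by rewrite mem_iota; lia.
rewrite (eq_bigl xpredT) => [|i]; last exact: mem_set.
rewrite big_map -[iota 0 n.+1]/(index_iota 0 n.+1) big_mkord.
by apply: eq_bigr => i _; congr (_ * v _); have := ltn_ord i; lia.
Qed.

Let trunc u (a : int) (n : nat) : {poly F} := \poly_(i < n.+1) u (a + i%:Z).

Lemma lmul_trunc u v (a b : int) (m n : nat) : (n <= m)%N ->
  (forall k, k < a -> u k = 0) -> (forall k, k < b -> v k = 0) ->
  lmul u v (a + b + n%:Z) = (trunc u a m * trunc v b m)`_n.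
Proof.
move=> nm ua vb; rewrite lmulE// coefM; apply: eq_bigr => i _.
by have := ltn_ord i => ni; rewrite !coef_poly !ifT//; lia.
Qed.

Fact laddA : associative ladd. Proof. by move=> u v w; apply: laurentP => n /=; rewrite addrA. Qed.
Fact laddC : commutative ladd. Proof. by move=> u v; apply: laurentP => n /=; rewrite addrC. Qed.
Fact ladd0 : left_id (lconst 0) ladd.
Proof. by move=> u; apply: laurentP => n /=; case: ifP; rewrite add0r. Qed.
Fact laddN : left_inverse (lconst 0) lopp ladd.
Proof. by move=> u; apply: laurentP => n /=; rewrite addNr; case: ifP. Qed.

HB.instance Definition _ :=
  GRing.isZmodule.Build (laurent F) laddA laddC ladd0 laddN.

Fact lmulC : commutative lmul.
Proof.
move=> u v; have [a ua] := lcoef_bounded u; have [b vb] := lcoef_bounded v.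
apply: laurentP => n; have [nab|] := ltP n (a + b).
  by rewrite /= (lmul_coef0 ua vb)// (lmul_coef0 vb ua)// addrC.
move=> nab; have -> : n = a + b + (absz (n - (a + b))%R)%:Z by lia.
by rewrite (lmul_trunc (leqnn _))// mulrC [a + b]addrC -(lmul_trunc (leqnn _)).
Qed.

Lemma lmul_lt u v (a b : int) : (forall k, k < a -> u k = 0) ->
  (forall k, k < b -> v k = 0) -> forall k, k < a + b -> lmul u v k = 0.
Proof. by move=> ua vb k; apply: lmul_coef0. Qed.

Fact lmulA : associative lmul.
Proof.
move=> u v w; have [a ua] := lcoef_bounded u.
have [b vb] := lcoef_bounded v; have [c wc] := lcoef_bounded w.
have uvab := lmul_lt ua vb; have vwbc := lmul_lt vb wc.
apply: laurentP => n; have [nabc|nabc] := ltP n (a + b + c).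
  by rewrite (lmul_lt uvab wc)// (lmul_lt ua vwbc)// addrA.
have -> : n = a + b + c + (absz (n - (a + b + c))%R)%:Z by lia.
set m := absz _; rewrite -{1}(addrA a) (lmulE _ ua vwbc) (lmulE _ uvab wc).
transitivity ((trunc u a m * (trunc v b m * trunc w c m))`_m).
  rewrite coefM; apply: eq_bigr => i _; have := ltn_ord i => im.
  by rewrite coef_poly im -(lmul_trunc (leq_subr _ _) vb wc).
rewrite mulrA coefM; apply: eq_bigr => i _; have := ltn_ord i => im.
rewrite [X in _ * X]coef_poly ltnS leq_subr (@lmul_trunc _ _ _ _ m _ _ ua vb)//; lia.
Qed.

Fact lmul1 : left_id (lconst 1) lmul.
Proof.
move=> u; apply: laurentP => n; rewrite /= /lmul_coef.
rewrite (fsbigE [:: 0])// => [|k _]; last first.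
  by rewrite inE => /negbTE /= ->; rewrite mul0r.
by rewrite big_mkcond big_seq1 ifT ?mem_set//= mul1r subr0.
Qed.

Fact lmulD : left_distributive lmul ladd.
Proof.
move=> u v w; have [a uva] := lcoef_bounded2 u v; have [c wc] := lcoef_bounded w.
have ua k : k < a -> u k = 0 by move=> /uva[].
have va k : k < a -> v k = 0 by move=> /uva[].
have uv k : k < a -> ladd u v k = 0 by move=> /uva[/= -> ->]; rewrite addr0.
apply: laurentP => n; have [nac|nac] := ltP n (a + c).
  by rewrite (lmul_lt uv wc)//= !(lmul_coef0 _ wc nac)// addr0.
have -> : n = a + c + (absz (n - (a + c))%R)%:Z by lia.
set m := absz _.
rewrite (lmulE _ uv wc).
transitivity (lmul u w (a + c + m%:Z) + lmul v w (a + c + m%:Z)) => //.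
rewrite !lmulE// -big_split/=.
by apply: eq_bigr => i _; rewrite mulrDl.
Qed.

Fact l1_neq0 : lconst 1 != 0.
Proof.
apply/eqP => /(congr1 (fun u => lcoef u 0)) /= /eqP.
by apply/negP/oner_neq0.
Qed.

HB.instance Definition _ := GRing.Zmodule_isComNzRing.Build (laurent F)
  lmulA lmulC lmul1 lmulD l1_neq0.

Lemma laurent_neq0 u : u != 0 ->
  exists m : int, u m != 0 /\ forall n, n < m -> u n = 0.
Proof.
move=> u0; have [a ua] := lcoef_bounded u.
have [n un] : exists n : nat, u (a + n%:Z) != 0.
  apply/not_existsP => u00; case/eqP: u0; apply: laurentP => n.
  rewrite [RHS]/=; case: ifP => _; have [/ua//|an] := ltP n a;
    by have /negP := u00 (absz (n - a)%R); rewrite negbK gez0_abs ?subr_ge0// addrC subrK => /eqP.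
have ex : exists n : nat, u (a + n%:Z) != 0 by exists n.
case: (ex_minnP ex) => m um mP; exists (a + m%:Z); split=> // k kam.
have [/ua//|ak] := ltP k a; apply/eqP; apply: contraT => uk.
have := mP (absz (k - a)%R); rewrite gez0_abs ?subr_ge0// addrC subrK => /(_ uk).
by lia.
Qed.

Fixpoint linv_seq (u : nat -> F) (n : nat) : seq F :=
  if n is n'.+1 then
    let s := linv_seq u n' in
    rcons s ((u 0)^-1 * ((n' == 0)%:R - \sum_(i < n') u (n' - i)%N * s`_i))
  else [::].

Lemma linv_ex u : exists v, if u == 0 then v = 0 else v * u = 1.
Proof.
have [_|u0] := eqVneq u 0; first by exists 0.
have [a [ua0 ua]] := laurent_neq0 u0.
pose c n := u (a + n%:Z); pose s := linv_seq c.
have ss n : size (s n) = n by elim: n => //= n ih; rewrite size_rcons ih.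
have sn m n : (n < m)%N -> (s m)`_n = (s n.+1)`_n.
  elim: m => // m ih; rewrite ltnS leq_eqVlt => /orP[/eqP->//|nm].
  by rewrite {1}/s /= nth_rcons -/(s m) ss nm ih.
pose d (n : int) := if n < - a then 0 else (s (absz (n + a)%R).+1)`_(absz (n + a)%R).
have db : exists m : int, forall n, n < m -> d n = 0.
  by exists (- a) => n; rewrite /d => ->.
exists (Laurent db); rewrite mulrC.
have dE (i : nat) : Laurent db (- a + i%:Z) = (s i.+1)`_i.
  rewrite /= /d ifF; last by lia.
  by have -> : absz (- a + i%:Z + a)%R = i by lia.
have d0 k : k < - a -> Laurent db k = 0 by rewrite /= /d => ->.
apply: laurentP => n; have [n0|n0] := ltP n 0.
  by rewrite (lmul_lt ua d0) ?addrN//= lt_eqF.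
have -> : n = a - a + (absz n)%:Z by lia.
rewrite (lmulE _ ua d0); set m := (absz n).
rewrite (reindex_inj rev_ord_inj) big_ord_recr /= -/m.
rewrite subSS subnn addr0 subn0.
under eq_bigr => i _.
  have im := ltn_ord i.
  rewrite subSS (_ : (m - (m - i))%N = i); last by lia.
  rewrite [d _]dE -(sn m)// -/(c _); over.
rewrite [d _]dE {2}/s /= -/(s m) nth_rcons ss ltnn eqxx.
have c0 : c 0%N = u a by rewrite /c addr0.
rewrite c0 mulrA mulfV// mul1r addrC subrK.
have -> : (a - a + m%:Z == 0) = (m == 0)%N by lia.
by case: eqP.
Qed.

Definition linv u : laurent F := sval (cid (linv_ex u)).

Fact lmulV u : u != 0 -> linv u * u = 1.
Proof. by rewrite /linv; case: cid => v /=; case: eqP. Qed.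

Fact linv0 : linv 0 = 0.
Proof. by rewrite /linv; case: cid => v /=; rewrite eqxx. Qed.

HB.instance Definition _ :=
  GRing.ComNzRing_isField.Build (laurent F) lmulV linv0.

End LaurentField.

(* [iter_laurent K r] is K((t_r))...((t_1)) with t_i = x_i^(1/p), which is
   the term of index p in the union K((x_r^(1/p)))...((x_1^(1/p))) over p; t_1
   is the outermost variable.  An element is read as the
   generalized series of the c_n x^(n/p), where c_n = [scoef s n]: all
   exponents are stored multiplied by p, so that n is in Z^r. *)
Fixpoint iter_laurent (K : fieldType) (r : nat) : fieldType :=
  if r is r'.+1 then laurent (iter_laurent K r') else K.

Fixpoint scoef (K : fieldType) (r : nat) :
    iter_laurent K r -> r.-tuple int -> K :=
  if r is r'.+1 then fun s n => scoef (lcoef s (thead n)) (behead_tuple n)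
  else fun s _ => s.

Fixpoint tvar (K : fieldType) (r i : nat) : iter_laurent K r :=
  match r, i with
  | 0, _ => 0
  | r'.+1, 0 => lX (iter_laurent K r')
  | r'.+1, i'.+1 => lconst (tvar K r' i')
  end.

Definition xvar (K : fieldType) (r p : nat) (i : 'I_r) : iter_laurent K r :=
  tvar K r i ^+ p.

Definition xexp (r p : nat) (m : r.-tuple nat) : r.-tuple int :=
  map_tuple (fun k : nat => (p * k)%N%:Z) m.

(* zeta^m = prod_i (x_i / x_(i+1)^q_i)^(m_i/p) is x^(zexp q m / p): the
   exponent of x_i is (m_i - q_(i-1) m_(i-1))/p, with q_0 = 0. *)
Definition zexp (r : nat) (q : r.-1.-tuple nat) (m : r.-tuple nat) :
    r.-tuple int :=
  [tuple of mkseq (fun i => (nth 0%N m i)%:Z -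
     (if i is j.+1 then (nth 0%N q j * nth 0%N m j)%N else 0%N)%:Z) r].

(* The subrings K[[x]] and K[[zeta]] of the Laurent field are cut out by the
   support: only monomials x^m, respectively zeta^m, with m in N^r occur. *)
Definition in_Kx (K : fieldType) (r p : nat) (s : iter_laurent K r) : Prop :=
  forall n, scoef s n != 0 -> exists m, n = xexp p m.

Definition in_Kzeta (K : fieldType) (r : nat) (q : r.-1.-tuple nat)
    (s : iter_laurent K r) : Prop :=
  forall n, scoef s n != 0 -> exists m, n = zexp q m.

Definition in_Kx_y (K : fieldType) (r p : nat) (Q : {poly iter_laurent K r}) :
    Prop :=
  forall j, in_Kx p Q`_j.

(* The coefficient of x^i y^j in Q. *)
Definition xycoef (K : fieldType) (r p : nat) (Q : {poly iter_laurent K r})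
    (i : r.-tuple nat) (j : nat) : K :=
  scoef Q`_j (xexp p i).

(* The ideal (x)^k K[[x]][y], generated by the products of k variables. *)
Definition in_xideal (K : fieldType) (r p k : nat)
    (Q : {poly iter_laurent K r}) : Prop :=
  exists A : k.-tuple 'I_r -> {poly iter_laurent K r},
    (forall t, in_Kx_y p (A t)) /\
    Q = \sum_(t : k.-tuple 'I_r) (\prod_(i <- t) xvar K p i) *: A t.

Definition xadic_order_le (K : fieldType) (r p nu0 : nat)
    (Q : {poly iter_laurent K r}) : Prop :=
  Q != 0 /\ forall k, in_xideal p k Q -> (k <= nu0)%N.

Definition is_lexval (K : fieldType) (r : nat) (q : r.-1.-tuple nat)
    (s : iter_laurent K r) (a : r.-tuple nat) : Prop :=
  scoef s (zexp q a) != 0 /\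
  forall m : r.-tuple nat, scoef s (zexp q m) != 0 ->
    ((a : r.-tuplelexi nat) <= (m : r.-tuplelexi nat))%O.

(* Indices start at 0: [qprime q b k] is q'_(k+1) = q_(k+1) + b_(k+2) + 1. *)
Definition qprime (r : nat) (q : r.-1.-tuple nat) (b : r.-tuple nat) (k : nat) :
    nat :=
  (nth 0 q k + nth 0 b k.+1 + 1)%N.

Definition Ltilde (r : nat) (q : r.-1.-tuple nat) (b : r.-tuple nat)
    (n : r.-tuple int) : int :=
  \sum_(i < r) (\prod_(i <= k < r.-1) qprime q b k)%N%:Z * tnth n i.

Definition Qset (K : fieldType) (r d nu0 p : nat) (q : r.-1.-tuple nat)
    (b : r.-tuple nat) (y0 : iter_laurent K r) (nu : nat)
    (Q : {poly iter_laurent K r}) : Prop :=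
  [/\ in_Kx_y p Q, (size Q <= d.+1)%N, xadic_order_le p nu0 Q &
      forall n, scoef Q.[y0] n != 0 -> nu%:Z <= Ltilde q b n].

Definition index_set (r d N : nat) : finType :=
  {u : r.-tuple 'I_N.+1 * 'I_d.+1 | (\sum_(k <- u.1) k <= N)%N}.

Definition index_x (r d N : nat) (u : index_set r d N) : r.-tuple nat :=
  map_tuple (@nat_of_ord N.+1) (val u).1.

Definition index_y (r d N : nat) (u : index_set r d N) : nat := (val u).2.

Definition parametric_description (K : fieldType) (r d nu0 p : nat)
    (S : {poly iter_laurent K r} -> Prop) (N : nat)
    (bs : seq {ffun index_set r d N -> K^o}) : Prop :=
  [/\ (nu0 <= N)%N, free bs &
      forall Q : {poly iter_laurent K r}, in_Kx_y p Q -> (size Q <= d.+1)%N ->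
        (S Q <->
         (exists theta : 'I_(size bs) -> K,
            [ffun u => xycoef p Q (index_x u) (index_y u)] =
            \sum_(m < size bs) theta m *: bs`_m) /\
         (exists (i : r.-tuple nat) (j : nat), (sumn i <= nu0)%N /\ xycoef p Q i j != 0))].

(* Data handled by algorithms: finite trees whose leaves are natural numbers
   and elements of K. *)
Inductive val_of (K : Type) : Type :=
  | VNat of nat
  | VElt of K
  | VNil
  | VCons of val_of K & val_of K.
Arguments VNat {K} n.
Arguments VNil {K}.

Definition vlist (K : Type) (s : seq (val_of K)) : val_of K :=
  foldr (@VCons K) VNil s.

Definition vnats (K : Type) (s : seq nat) : val_of K := vlist (map VNat s).

(* Algorithms are programs of a Turing-complete language without variables: a
   program maps a value to a value.  The text of a program contains no element
   of K, and K is only accessible through the constants 0 and 1, the field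
   operations, the zero test and the answers of the procedure called by
   [PAsk].  A test succeeds when it returns a nonzero natural number. *)
Inductive prog : Type :=
  | PId
  | PSeq of prog & prog
  | PNil
  | PCons of prog & prog
  | PCar
  | PCdr
  | PIsNil
  | PNat of nat
  | PAdd
  | PSub
  | PMul
  | PElt0
  | PElt1
  | PEltAdd
  | PEltOpp
  | PEltMul
  | PEltInv
  | PEltIs0
  | PIf of prog & prog & prog
  | PWhile of prog & prog
  | PAsk.

Inductive run (K : fieldType) (ask : nat -> val_of K) :
    prog -> val_of K -> val_of K -> Prop :=
  | run_id u : run ask PId u u
  | run_seq a b u v w : run ask a u v -> run ask b v w -> run ask (PSeq a b) u w
  | run_nil u : run ask PNil u VNil
  | run_cons a b u v w :
      run ask a u v -> run ask b u w -> run ask (PCons a b) u (VCons v w)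
  | run_car u v : run ask PCar (VCons u v) u
  | run_cdr u v : run ask PCdr (VCons u v) v
  | run_isnil_nil : run ask PIsNil VNil (VNat 1)
  | run_isnil_cons u v : run ask PIsNil (VCons u v) (VNat 0)
  | run_nat n u : run ask (PNat n) u (VNat n)
  | run_add m n : run ask PAdd (VCons (VNat m) (VNat n)) (VNat (m + n))
  | run_sub m n : run ask PSub (VCons (VNat m) (VNat n)) (VNat (m - n))
  | run_mul m n : run ask PMul (VCons (VNat m) (VNat n)) (VNat (m * n))
  | run_elt0 u : run ask PElt0 u (VElt 0)
  | run_elt1 u : run ask PElt1 u (VElt 1)
  | run_eltadd x y : run ask PEltAdd (VCons (VElt x) (VElt y)) (VElt (x + y))
  | run_eltopp x : run ask PEltOpp (VElt x) (VElt (- x))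
  | run_eltmul x y : run ask PEltMul (VCons (VElt x) (VElt y)) (VElt (x * y))
  | run_eltinv x : x != 0 -> run ask PEltInv (VElt x) (VElt x^-1)
  | run_eltis0 x : run ask PEltIs0 (VElt x) (VNat (x == 0))
  | run_if_true c a b u v n :
      run ask c u (VNat n.+1) -> run ask a u v -> run ask (PIf c a b) u v
  | run_if_false c a b u v :
      run ask c u (VNat 0) -> run ask b u v -> run ask (PIf c a b) u v
  | run_while_stop c a u : run ask c u (VNat 0) -> run ask (PWhile c a) u u
  | run_while_step c a u v w n :
      run ask c u (VNat n.+1) -> run ask a u v -> run ask (PWhile c a) v w ->
      run ask (PWhile c a) u w
  | run_ask n : run ask PAsk (VNat n) (ask n).

Lemma run_det (K : fieldType) (ask : nat -> val_of K) a u v w :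
  run ask a u v -> run ask a u w -> v = w.
Proof.
move=> auv; elim: auv w => {a u v}; intros;
  match goal with H : run _ _ _ ?w |- _ = ?w => inversion H; subst end;
  repeat match goal with
  | IH : forall w, run _ ?a ?u w -> _ = w, H : run _ ?a ?u _ |- _ =>
    let E := fresh in
    pose proof (IH _ H) as E; clear H; try discriminate E; subst
  end; congruence.
Qed.

(* [v] lists, in some order and without repetition, the pairs (key i, c i)
   for all the indices i satisfying D. *)
Definition is_table (K : Type) (I : eqType) (key : I -> val_of K)
    (D : {pred I}) (c : I -> K) (v : val_of K) : Prop :=
  exists s : seq I, [/\ uniq s, s =i D &
    v = vlist [seq VCons (key i) (VElt (c i)) | i <- s]].

Definition zeta_table (K : fieldType) (r : nat) (q : r.-1.-tuple nat)
    (s : iter_laurent K r) (k : nat) : val_of K -> Prop :=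
  is_table (fun m : r.-tuple nat => vnats K m) [pred m : r.-tuple nat | (sumn m <= k)%N]
           (fun m => scoef s (zexp q m)).

Definition coef_procedure (K : fieldType) (r : nat) (q : r.-1.-tuple nat)
    (f g : iter_laurent K r) (ask : nat -> val_of K) : Prop :=
  forall k, exists tf tg,
    [/\ ask k = VCons tf tg, zeta_table q f k tf & zeta_table q g k tg].

Definition input_data (K : Type) (r d nu0 p : nat) (q : r.-1.-tuple nat)
    (nu : nat) (valf valg : r.-tuple nat) : val_of K :=
  vlist [:: VNat d; VNat nu0; VNat p; vnats K q; VNat nu;
            vnats K valf; vnats K valg].

Definition output_data (K : fieldType) (r d N : nat)
    (bs : seq {ffun index_set r d N -> K^o}) (v : val_of K) : Prop :=
  exists rows : seq (val_of K),
    [/\ v = VCons (VNat N) (vlist rows), size rows = size bs &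
        forall m, (m < size bs)%N ->
          is_table (fun u => VCons (vnats K (index_x u)) (VNat (index_y u)))
                   predT (bs`_m) (nth VNil rows m)].

(* Main.v *)
(* Let w be the weight that Ltilde induces on the monomials.  The choice of q' makes the
   lexicographically smallest monomial of g also one of least weight, so that 1/g,
   expanded lexicographically, has all its monomials of weight at least -w(g).
   Hence Q(y0) has weight at least nu if and only if the sum of the
   Q_j f^j g^(d-j), which is g^d Q(y0), has weight at least
   mu = nu + d w(g).  All zeta_i and x_i have weight at least 1, so this involves
   only coefficients of Q, f and g of total degree at most mu: Q_nu is cut out by
   finitely many linear conditions, whose space of solutions is computed by
   elimination, together with the condition on the order, which says that some
   coefficient of Q of degree at most nu0 is nonzero. *)
From HB Require Import structures.
Require Import Defs.
From mathcomp Require Import all_boot all_order all_algebra.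
From mathcomp Require Import boolp classical_sets fsbigop.
From mathcomp Require Import zify ring.
Set Implicit Arguments.
Unset Strict Implicit.
Unset Printing Implicit Defensive.
Import Order.TTheory GRing.Theory Num.Theory.
Local Open Scope ring_scope.

(** * Iterated Laurent series and their weight filtration *)

(** In the iterated Laurent field the conditions [weight at least k] form a filtration compatible
    with sums and products. The delicate point is 1/g, whose support is infinite: the bound on its
    weights is proved by induction on r, the leading coefficient of g in the outermost variable
    being itself an iterated series. That the smallest monomial of g has least weight rests on two
    facts: its exponent is bounded componentwise by beta, the sum of the valuations of f and g, and
    each zeta_i outweighs the part of zeta^beta in the later variables. The program calls the
    procedure once, in degree N = nu0 + mu. The keys of the answer serve as its enumeration of
    exponents, so that their order is harmless. A polynomial Q is represented by its values under
    the conditions, followed by its coordinates; elimination is then arithmetic on rows and drops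
    one column per condition. The programs follow left folds on mathematical objects, about which
    correctness is proved. *)

Section LaurentMonomials.
Variable F : fieldType.
Implicit Types u v : laurent F.

Lemma lcoefM u v n : (u * v) n = \sum_(k \in [set: int]) u k * v (n - k).
Proof. by []. Qed.

Fact lmono_bounded (a : int) (c : F) :
  exists m : int, forall n : int, n < m -> (if n == a then c else 0) = 0.
Proof. by exists a => n na; rewrite lt_eqF. Qed.
Definition lmono (a : int) (c : F) : laurent F := Laurent (lmono_bounded a c).

Lemma lcoefMmono a c u n : (lmono a c * u) n = c * u (n - a).
Proof.
rewrite lcoefM (fsbigE [:: a])// => [|k _]; last first.
  by rewrite inE => /negbTE /= ->; rewrite mul0r.
by rewrite big_mkcond big_seq1 ifT ?mem_set//= eqxx.
Qed.

Lemma lcoefM_lead u v (a b : int) :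
  (forall k, k < a -> u k = 0) -> (forall k, k < b -> v k = 0) ->
  (u * v) (a + b) = u a * v b.
Proof.
move=> ua vb; have := lmulE 0 ua vb; rewrite addr0 => ->.
by rewrite big_ord_recl big_ord0 !addr0.
Qed.

End LaurentMonomials.

Section IteratedLaurent.
Variable K : fieldType.

(* [scoef], with the exponents as functions on nat, of which only the values
   at i < r matter. *)
Fixpoint fcoef (r : nat) : iter_laurent K r -> (nat -> int) -> K :=
  if r is r'.+1 then fun s e => fcoef (lcoef s (e 0%N)) (e \o succn)
  else fun s _ => s.

Lemma eq_fcoef r (s : iter_laurent K r) e e' :
  (forall i, (i < r)%N -> e i = e' i) -> fcoef s e = fcoef s e'.
Proof.
elim: r s e e' => //= r ih s e e' ee; rewrite (ee 0%N)//.
by apply: ih => i ir; apply: ee.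
Qed.

Lemma scoefE r (s : iter_laurent K r) n : scoef s n = fcoef s (nth 0 n).
Proof.
elim: r s n => //= r ih s n; rewrite ih.
have -> : thead n = nth 0 n 0 by rewrite /thead (tnth_nth 0).
by apply: eq_fcoef => i _ /=; rewrite nth_behead.
Qed.

Lemma fcoefE r (s : iter_laurent K r) e : fcoef s e = scoef s [tuple e i | i < r].
Proof.
rewrite scoefE; apply: eq_fcoef => i ir.
by rewrite -[i]/(nat_of_ord (Ordinal ir)) -tnth_nth tnth_mktuple.
Qed.

Lemma fcoef_inj r (s t : iter_laurent K r) : fcoef s =1 fcoef t -> s = t.
Proof.
elim: r s t => [|r ih] s t st; first exact: (st (fun=> 0)).
apply: laurentP => a; apply: ih => e.
by have := st (fun i => if i is j.+1 then e j else a).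
Qed.

Lemma fcoef0 r e : fcoef (0 : iter_laurent K r) e = 0.
Proof. by elim: r e => //= r ih e; case: ifP. Qed.

Lemma fcoefD r (s t : iter_laurent K r) e :
  fcoef (s + t) e = fcoef s e + fcoef t e.
Proof. by elim: r s t e => //= r ih s t e. Qed.

Lemma fcoefN r (s : iter_laurent K r) e : fcoef (- s) e = - fcoef s e.
Proof. by elim: r s e => //= r ih s e. Qed.

Lemma fcoefB r (s t : iter_laurent K r) e :
  fcoef (s - t) e = fcoef s e - fcoef t e.
Proof. by rewrite fcoefD fcoefN. Qed.

Lemma fcoef_sum r I (l : seq I) (P : pred I) (s : I -> iter_laurent K r) e :
  fcoef (\sum_(i <- l | P i) s i) e = \sum_(i <- l | P i) fcoef (s i) e.
Proof.
by apply: (big_morph (fun s => fcoef s e)) => [s1 s2|]; rewrite ?fcoefD ?fcoef0.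
Qed.

Fixpoint mono (r : nat) (e : nat -> int) (c : K) : iter_laurent K r :=
  if r is r'.+1 then lmono (e 0%N) (mono r' (e \o succn) c) else c.

Lemma fcoefMmono r e c (s : iter_laurent K r) e' :
  fcoef (mono r e c * s) e' = c * fcoef s (fun i => e' i - e i).
Proof.
elim: r e e' s => [//|r ih] e e' s.
transitivity (fcoef ((lmono (e 0%N) (mono r (e \o succn) c) * (s : laurent _)) (e' 0%N))
  (e' \o succn)) => //.
by rewrite lcoefMmono ih.
Qed.

Lemma eq_mono r e e' c :
  (forall i, (i < r)%N -> e i = e' i) -> mono r e c = mono r e' c.
Proof.
elim: r e e' => //= r ih e e' ee; rewrite (ee 0%N)//; congr lmono.
by apply: ih => i ir; apply: ee.
Qed.

Lemma mono_fcoef r e c :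
  fcoef (mono r e c) e = c.
Proof. by elim: r e => //= r ih e; rewrite eqxx ih. Qed.

Lemma fcoef_mono_neq0 r e c e' : fcoef (mono r e c) e' != 0 ->
  forall i, (i < r)%N -> e' i = e i.
Proof.
elim: r e e' => //= r ih e e'; case: (eqVneq (e' 0%N)) => [e0|_]; last by rewrite fcoef0 eqxx.
by move=> /ih ee [|i] ir //; apply: ee.
Qed.

Lemma monoM r e e' c c' :
  mono r e c * mono r e' c' = mono r (fun i => e i + e' i) (c * c').
Proof.
elim: r e e' => [//|r ih] e e'; apply: laurentP => n.
transitivity ((lmono (e 0%N) (mono r (e \o succn) c) *
  lmono (e' 0%N) (mono r (e' \o succn) c')) n) => //.
rewrite lcoefMmono /= subr_eq addrC.
by case: ifP => _; rewrite ?mulr0// ih.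
Qed.

Lemma mono0 r : mono r (fun=> 0) 1 = 1.
Proof. by elim: r => //= r ih; apply: laurentP => n /=; rewrite ih. Qed.

Lemma monoX r e c n : mono r e c ^+ n = mono r (fun i => e i *+ n) (c ^+ n).
Proof.
elim: n => [|n ih]; first by rewrite expr0 -(mono0 r).
rewrite exprS ih monoM -exprS; apply: eq_mono => i _.
by rewrite -mulrS.
Qed.

Lemma tvarE r i : (i < r)%N -> tvar K r i = mono r (fun j => (i == j)%N%:Z) 1.
Proof.
elim: r i => //= r ih [_|i ir].
  by apply: laurentP => n /=; rewrite mono0; case: eqP.
apply: laurentP => n /=; case: eqP => // _; exact: ih.
Qed.

Definition wform (w : nat -> int) (r : nat) (e : nat -> int) : int :=
  \sum_(i < r) w i * e i.

Lemma wformS w r e : wform w r.+1 e = w 0%N * e 0%N + wform (w \o succn) r (e \o succn).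
Proof. by rewrite /wform big_ord_recl. Qed.

Lemma eq_wform w r e e' :
  (forall i, (i < r)%N -> e i = e' i) -> wform w r e = wform w r e'.
Proof. by move=> ee; apply: eq_bigr => i _; rewrite ee. Qed.

(** The filtration by weight. Its compatibility with the field operations replaces an analysis of
    the supports of products and inverses. *)
Definition wge (w : nat -> int) (r : nat) (k : int) (s : iter_laurent K r) :=
  forall e, fcoef s e != 0 -> k <= wform w r e.

(** Peeling off the outermost variable turns the bound into one on each coefficient, which opens the
    way to induction on [r]. *)
Lemma wgeS w r k (s : iter_laurent K r.+1) :
  wge w k s <-> forall a, wge (w \o succn) (k - w 0%N * a) (lcoef s a).
Proof.
split=> [ws a e sae|ws e se]; last by rewrite wformS -lerBlDl; apply: ws.
have := ws (fun i => if i is j.+1 then e j else a) sae.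
by rewrite wformS /= lerBlDl.
Qed.

Lemma wge_le w r k l (s : iter_laurent K r) : l <= k -> wge w k s -> wge w l s.
Proof. by move=> lk ws e /ws; apply: le_trans. Qed.

Lemma wge0 w r k : wge w k (0 : iter_laurent K r).
Proof. by move=> e; rewrite fcoef0 eqxx. Qed.

Lemma wgeD w r k (s t : iter_laurent K r) : wge w k s -> wge w k t -> wge w k (s + t).
Proof.
move=> ws wt e; rewrite fcoefD; have [s0|/ws//] := eqVneq (fcoef s e) 0.
by rewrite s0 add0r => /wt.
Qed.

Lemma wgeN w r k (s : iter_laurent K r) : wge w k s -> wge w k (- s).
Proof. by move=> ws e; rewrite fcoefN oppr_eq0 => /ws. Qed.

Lemma wgeB w r k (s t : iter_laurent K r) : wge w k s -> wge w k t -> wge w k (s - t).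
Proof. by move=> ws wt; apply: wgeD => //; apply: wgeN. Qed.

Lemma wge_sum w r k I (l : seq I) (P : pred I) (s : I -> iter_laurent K r) :
  (forall i, P i -> wge w k (s i)) -> wge w k (\sum_(i <- l | P i) s i).
Proof. by move=> ws; apply: big_ind => //; [apply: wge0|apply: wgeD]. Qed.

Lemma wgeM w r k l (s t : iter_laurent K r) :
  wge w k s -> wge w l t -> wge w (k + l) (s * t).
Proof.
elim: r w k l s t => [|r ih] w k l s t ws wt.
  move=> e; rewrite /wform big_ord0 /= mulf_eq0 negb_or => /andP[s0 t0].
  by rewrite -[0](addr0 0) lerD//; [have := ws e s0|have := wt e t0]; rewrite /wform big_ord0.
move/wgeS in ws; move/wgeS in wt; apply/wgeS => a.
suff : wge (w \o succn) (k + l - w 0%N * a) ((s * t : laurent _) a) by [].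
rewrite lcoefM; apply: wge_sum => b _.
have -> : k + l - w 0%N * a = (k - w 0%N * b) + (l - w 0%N * (a - b)) by ring.
exact: ih.
Qed.

Lemma wgeX w r k (s : iter_laurent K r) n : wge w k s -> wge w (k *+ n) (s ^+ n).
Proof.
move=> ws; elim: n => [|n ih]; last by rewrite exprS mulrS; apply: wgeM.
rewrite expr0 mulr0n -mono0 => e /fcoef_mono_neq0 e0.
by rewrite (eq_wform _ e0) /wform big1// => i _; rewrite mulr0.
Qed.

Lemma wge_mono w r e c : wge w (wform w r e) (mono r e c).
Proof. by move=> e' /fcoef_mono_neq0 e0; rewrite (eq_wform _ e0). Qed.

(* The lexicographically smallest exponent of s is e. *)
Fixpoint lead (r : nat) : iter_laurent K r -> (nat -> int) -> Prop :=
  if r is r'.+1 then fun s e =>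
    (forall a, a < e 0%N -> lcoef s a = 0) /\ lead (lcoef s (e 0%N)) (e \o succn)
  else fun s _ => s != 0.

Lemma lead_fcoef r (s : iter_laurent K r) e : lead s e -> fcoef s e != 0.
Proof. by elim: r s e => //= r ih s e [_ /ih]. Qed.

Lemma lead_neq0 r (s : iter_laurent K r) e : lead s e -> s != 0.
Proof. by move=> /lead_fcoef; apply: contraNneq => ->; rewrite fcoef0. Qed.

(** Lexicographic minimality is expressed by first differences, a form that survives the passage to
    the coefficients in the remaining variables. *)
Lemma leadP r (s : iter_laurent K r) e : fcoef s e != 0 ->
  (forall e' k, fcoef s e' != 0 -> (k < r)%N ->
     (forall i, (i < k)%N -> e' i = e i) -> e k <= e' k) -> lead s e.
Proof.
elim: r s e => //= r ih s e se mine; split=> [a ae|].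
  apply: fcoef_inj => e'; rewrite fcoef0; apply/eqP; apply: contraTT ae => se'.
  have := mine (fun i => if i is j.+1 then e' j else a) 0%N se' isT.
  by rewrite -leNgt; apply.
apply: ih => // e' k se' kr ee'.
apply: (mine (fun i => if i is j.+1 then e' j else e 0%N) k.+1) => //.
by case=> // i ik; apply: ee'.
Qed.

Lemma leadM r (s t : iter_laurent K r) e e' :
  lead s e -> lead t e' -> lead (s * t) (fun i => e i + e' i).
Proof.
elim: r s t e e' => [|r ih] s t e e'; first exact: mulf_neq0.
move=> [s0 s1] [t0 t1]; split; first exact: lmul_lt.
suff : lead ((s * t : laurent _) (e 0%N + e' 0%N)) ((fun i => e i + e' i) \o succn) by [].
by rewrite (lcoefM_lead s0 t0); apply: ih.
Qed.

Lemma wge1 w r : wge w 0 (1 : iter_laurent K r).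
Proof. by have := wgeX (n := 0) (@wge0 w r 0); rewrite expr0. Qed.

(* The coefficients of 1/s obey the usual recursion, which only divides by the
   leading coefficient of s. *)
Lemma wgeV w r (s : iter_laurent K r) e :
  lead s e -> wge w (wform w r e) s -> wge w (- wform w r e) s^-1.
Proof.
elim: r w s e => [|r ih] w s e.
  by move=> _ _ e' _; rewrite /wform !big_ord0 oppr0.
move=> se ws; have sn0 := lead_neq0 se; case: se => s0 s1.
set k := wform w r.+1 e; set b := e 0%N in s0 s1.
have ks : k - w 0%N * b = wform (w \o succn) r (e \o succn).
  by rewrite /k wformS addrC addKr.
move/wgeS in ws; rewrite -/k in ws.
pose v : laurent (iter_laurent K r) := s^-1.
have sv : (s : laurent _) * v = 1 by apply: mulfV.
(* The leading terms of [s] and 1/s multiply to a nonzero term of 1, which can only be the one in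
   degree 0. *)
have v0 a : a < - b -> v a = 0.
  have vn0 : v != 0 by apply: invr_neq0.
  have [m [vm v0]] := laurent_neq0 vn0.
  have smv : ((s : laurent _) * v) (b + m) != 0.
    by rewrite (lcoefM_lead s0 v0) mulf_neq0// (lead_neq0 s1).
  suff <- : m = - b by apply: v0.
  move: smv; rewrite sv /=; case: (eqVneq (b + m)) => [bm _|_]; last by rewrite eqxx.
  by apply/eqP; rewrite -subr_eq0 opprK addrC bm.
have s1V : wge (w \o succn) (- (k - w 0%N * b)) (lcoef s b)^-1.
  by rewrite ks; apply: ih; rewrite -?ks.
apply/wgeS => a; have [ab|ab] := ltP a (- b).
  by rewrite [lcoef _ a]v0//; apply: wge0.
have -> : a = - b + (absz (a + b)%R)%:Z by lia.
(* Strong induction on the distance [n] to the order [- b] of 1/s. *)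
elim/ltn_ind: (absz _) => {a ab} n ihn.
have := lmulE n s0 v0; rewrite addrN add0r.
rewrite (_ : lmul _ _ _ = lcoef (1 : laurent _) n%:Z); last by rewrite -sv.
rewrite big_ord_recl subn0 addr0; set S := \sum_(i < n) _ => svn.
have -> : lcoef s^-1 (- b + n%:Z) =
    (lcoef s b)^-1 * (lcoef (1 : laurent (iter_laurent K r)) n%:Z - S).
  by rewrite svn addrK mulKf// (lead_neq0 s1).
(* The bound splits into that of the inverse of the leading coefficient, given by the induction on
   [r], and that of the bracket. *)
have -> : - k - w 0%N * (- b + n%:Z) = - (k - w 0%N * b) + (- (w 0%N * n%:Z)) by ring.
apply: wgeM => //; apply: wgeB.
  rewrite /=; case: eqP => [->|_]; last exact: wge0.
  by rewrite mulr0 oppr0; apply: wge1.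
apply: wge_sum => i _; have im := ltn_ord i.
have -> : - (w 0%N * n%:Z) = (k - w 0%N * (b + (i.+1)%:Z)) +
    (- k - w 0%N * (- b + (n - i.+1)%N%:Z)).
  by rewrite -subzn//; ring.
by apply: wgeM; [apply: ws|apply: ihn; lia].
Qed.

End IteratedLaurent.

(** * The (x)-adic order *)

Section XMonomials.
Variables (K : fieldType) (r p : nat).

Lemma xexpE (m : r.-tuple nat) i : (i < r)%N ->
  nth 0 (xexp p m) i = (p * nth 0%N m i)%N%:Z.
Proof. by move=> ir; rewrite (nth_map 0%N) ?size_tuple. Qed.

Lemma xycoefE (Q : {poly iter_laurent K r}) m j :
  xycoef p Q m j = fcoef Q`_j (fun i => (p * nth 0%N m i)%N%:Z).
Proof. by rewrite /xycoef scoefE; apply: eq_fcoef => i ir; rewrite xexpE. Qed.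

Lemma in_KxP (s : iter_laurent K r) : in_Kx p s <->
  forall e, fcoef s e != 0 ->
    exists m : r.-tuple nat, forall i, (i < r)%N -> e i = (p * nth 0%N m i)%N%:Z.
Proof.
split=> [sx e|sx n]; rewrite (fcoefE, scoefE).
  by move=> /sx[m em]; exists m => i ir; rewrite -xexpE// -em (nth_mktuple _ _ (Ordinal ir)).
move=> /sx[m nm]; exists m; apply: eq_from_tnth => i.
by rewrite !(tnth_nth 0) nm// xexpE.
Qed.

Lemma prod_xvar (t : seq 'I_r) : \prod_(i <- t) xvar K p i =
  mono r (fun j => (p * count (fun i : 'I_r => i == j :> nat) t)%N%:Z) 1.
Proof.
elim: t => [|i t ih].
  by rewrite big_nil -mono0; apply: eq_mono => i _; rewrite muln0.
rewrite big_cons ih /xvar tvarE// monoX expr1n monoM mul1r.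
by apply: eq_mono => j _ /=; rewrite mulnDr PoszD; lia.
Qed.

End XMonomials.

Section PowerSeries.
Variables (K : fieldType) (p : nat).

Fact pser_bounded (F : fieldType) (c : nat -> F) :
  exists m : int, forall n : int, n < m ->
    (if (0 <= n) && (p %| absz n)%N then c (absz n %/ p)%N else 0) = 0.
Proof. by exists 0 => n n0; rewrite leNgt n0. Qed.

(** The element of K[[x]] with coefficients [c]. The divisibility test accounts for the exponents
    being stored multiplied by [p]. *)
Fixpoint pser (r : nat) (c : seq nat -> K) : iter_laurent K r :=
  if r is r'.+1 then Laurent (pser_bounded (fun n => pser r' (c \o cons n)))
  else c [::].

Lemma fcoef_pser r (c : seq nat -> K) (m : r.-tuple nat) : (0 < p)%N ->
  fcoef (pser r c) (fun i => (p * nth 0%N m i)%N%:Z) = c m.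
Proof.
move=> p_gt0; elim: r c m => [|r ih] c m; first by rewrite tuple0.
case/tupleP: m => n m /=; rewrite dvdn_mulr// mulKn//.
by have := ih (c \o cons n) m.
Qed.

Lemma in_Kx_pser r c : in_Kx p (pser r c).
Proof.
apply/in_KxP; elim: r c => [|r ih] c e /= c0; first by exists [tuple].
move: c0; case: ifP => [/andP[e0 pe]|_]; last by rewrite fcoef0 eqxx.
move=> /ih[m em]; exists [tuple of (absz (e 0%N) %/ p)%N :: m] => -[_|i /em//].
by rewrite /= mulnC divnK// gez0_abs.
Qed.

End PowerSeries.

(** Write x^m as a word in which each index [i] is repeated m_i times: its first [k] letters give a
    product of [k] variables dividing x^m. *)
Lemma tuple_of_counts r k (m : r.-tuple nat) : (k <= sumn m)%N ->
  exists t : k.-tuple 'I_r,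
    forall i : 'I_r, (count (fun j : 'I_r => j == i :> nat) t <= nth 0%N m i)%N.
Proof.
move=> km; pose L := flatten [seq nseq (tnth m i) i | i <- enum 'I_r].
have sL : size L = sumn m.
  rewrite size_flatten /shape -map_comp -[in RHS](map_tnth_enum m).
  by congr sumn; apply: eq_map => i /=; rewrite size_nseq.
have st : size (take k L) == k by rewrite size_takel// sL.
exists (Tuple st) => i /=.
have -> : nth 0%N m i = count (fun j : 'I_r => j == i :> nat) L.
  rewrite count_flatten -map_comp sumnE big_map big_enum_cond /= (bigD1 i)//=.
  rewrite count_nseq eqxx mul1n big1 ?addn0 -?tnth_nth// => j ji.
  by rewrite count_nseq -[_ == _ :> nat]/(j == i) (negbTE ji).
by rewrite -[in X in (_ <= X)%N](cat_take_drop k L) count_cat leq_addr.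
Qed.

Lemma Posz_sum I (l : seq I) (P : pred I) (F : I -> nat) :
  (\sum_(i <- l | P i) F i)%N%:Z = \sum_(i <- l | P i) (F i)%:Z.
Proof. exact: (big_morph Posz PoszD (erefl 0%:Z)). Qed.

Lemma sumn_tuple r (m : r.-tuple nat) : sumn m = (\sum_(i < r) nth 0 m i)%N.
Proof. by rewrite sumnE big_tuple; apply: eq_bigr => i _; rewrite (tnth_nth 0%N). Qed.

Lemma sum_count r (t : seq 'I_r) :
  (\sum_(i < r) count (fun j : 'I_r => j == i :> nat) t)%N = size t.
Proof.
elim: t => [|j t ih]; first by rewrite big1.
rewrite /= big_split /= ih (bigD1 j)//= eqxx big1 ?addn0// => i ij.
by rewrite eq_sym -[_ == _ :> nat]/(i == j) (negbTE ij).
Qed.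

Section XadicOrder.
Variables (K : fieldType) (r p : nat).
Hypothesis p_gt0 : (0 < p)%N.
Implicit Types (Q : {poly iter_laurent K r}) (m : r.-tuple nat).

Lemma wge_in_Kx (w : nat -> nat) (s : iter_laurent K r) :
  in_Kx p s -> wge (fun i => (w i)%:Z) 0 s.
Proof.
move=> /in_KxP sx e /sx[m em]; apply: sumr_ge0 => i _.
by rewrite em.
Qed.

(** When all weights are 1, a product of [k] variables weighs [p * k], hence so does at least every
    monomial of an element of (x)^k, whereas x^m weighs [p * sumn m]. *)
Lemma xadic_order_leI nu0 Q m j : (sumn m <= nu0)%N -> xycoef p Q m j != 0 ->
  xadic_order_le p nu0 Q.
Proof.
move=> mnu; rewrite xycoefE => Qmj; split.
  by apply: contraNneq Qmj => ->; rewrite coef0 fcoef0.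
move=> k [A [Ax QA]]; apply: leq_trans mnu; rewrite -(leq_pmul2l p_gt0) -lez_nat.
have -> : (p * sumn m)%N%:Z =
    wform (fun=> 1%N%:Z) r (fun i : nat => (p * nth 0%N m i)%N%:Z).
  by rewrite sumn_tuple big_distrr Posz_sum; apply: eq_bigr => i _; rewrite mul1r.
suff : wge (fun=> 1%N%:Z) (p * k)%N%:Z Q`_j by apply.
rewrite QA coef_sum; apply: wge_sum => t _; rewrite coefZ -[(p * k)%N%:Z]addr0.
apply: wgeM; last exact/(@wge_in_Kx (fun=> 1%N))/Ax.
rewrite prod_xvar; apply: wge_le; last exact: wge_mono.
rewrite -[k in (p * k)%N](size_tuple t) -sum_count big_distrr Posz_sum.
by apply: ler_sum => i _; rewrite mul1r.
Qed.

(** For the converse, if no coefficient of degree at most [nu0] survives, an explicit decomposition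
    puts [Q] in the ideal power of exponent [nu0.+1]. *)
Lemma xadic_order_leP nu0 Q : in_Kx_y p Q ->
  xadic_order_le p nu0 Q <->
  exists m j, (sumn m <= nu0)%N /\ xycoef p Q m j != 0.
Proof.
move=> Qx; split=> [[_ Qnu]|[m [j []]]]; last exact: xadic_order_leI.
apply: contrapT => Q0.
have {}Q0 m j : (sumn m <= nu0)%N -> xycoef p Q m j = 0.
  by move=> mnu; apply/eqP; apply: contraT => Qmj; case: Q0; exists m, j.
pose k := nu0.+1.
suff : in_xideal p k Q by move=> /Qnu; rewrite ltnn.
pose cnt (t : k.-tuple 'I_r) i := count (fun j : 'I_r => j == i :> nat) t.
(* [tau] chooses for each monomial one product of [k] variables dividing it, so that every monomial
   of [Q] is sent to a single summand. *)
pose tau (e : nat -> nat) := [pick t | [forall i : 'I_r, cnt t i <= e i]%N].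
have eq_tau e e' : (forall i, (i < r)%N -> e i = e' i) -> tau e = tau e'.
  by move=> ee; apply: eq_pick => t; apply: eq_forallb => i; rewrite ee.
(* The coefficient of x^l in the cofactor of the product [t] is that of x^l times the product in
   [Q], provided that this monomial is assigned to [t]. *)
pose c t j (l : seq nat) := if tau (fun i => nth 0 l i + cnt t i)%N == Some t
  then fcoef Q`_j (fun i => (p * (nth 0 l i + cnt t i))%N%:Z) else 0.
exists (fun t => \poly_(j < size Q) pser p r (c t j)); split.
  move=> t j; rewrite coef_poly; case: ifP => _; first exact: in_Kx_pser.
  by move=> n; rewrite scoefE fcoef0 eqxx.
apply/polyP => j; rewrite coef_sum; under eq_bigr do rewrite coefZ coef_poly.
case: ltnP => [_|Qj]; last first.
  by rewrite nth_default// big1// => t _; rewrite mulr0.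
apply: fcoef_inj => e; rewrite fcoef_sum.
under eq_bigr => t _ do rewrite prod_xvar fcoefMmono mul1r -/(cnt t _).
have suppt t (m : r.-tuple nat) :
    (forall i, (i < r)%N -> e i - (p * cnt t i)%N%:Z = (p * nth 0%N m i)%N%:Z) ->
    forall i, (i < r)%N -> e i = (p * (nth 0 m i + cnt t i))%N%:Z.
  by move=> em i /em; rewrite mulnDr PoszD => <-; rewrite subrK.
have [[m em]|em] := pselect (exists m : r.-tuple nat,
    forall i, (i < r)%N -> e i = (p * nth 0%N m i)%N%:Z); last first.
  have -> : fcoef Q`_j e = 0.
    by apply/eqP; apply: contraT => /((in_KxP _ _).1 (Qx j)).
  rewrite big1// => t _; apply/eqP; apply: contraT => /((in_KxP _ _).1 (@in_Kx_pser _ _ _ _)).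
  move=> [m /suppt em']; case: em; exists [tuple (nth 0 m i + cnt t i)%N | i < r].
  by move=> i ir; rewrite em'// (nth_mktuple _ _ (Ordinal ir)).
(* Only the product chosen for x^m contributes. If there is none, x^m has degree at most [nu0] and
   its coefficient is zero. *)
transitivity (\sum_(t : k.-tuple 'I_r)
    if tau (nth 0%N m) == Some t then fcoef Q`_j e else 0).
  rewrite -big_mkcond /=; case tm : (tau (nth 0%N m)) => [t|].
    by rewrite (big_pred1 t)// => t'; rewrite eq_sym.
  rewrite big_pred0//.
  have [mnu|/tuple_of_counts[t tm']] := leqP (sumn m) nu0.
    by rewrite (eq_fcoef _ em) -xycoefE Q0.
  by move: tm; rewrite /tau; case: pickP => // /(_ t) /forallP[].
apply: eq_bigr => t _.
have [tm|tm] := boolP [forall i : 'I_r, cnt t i <= nth 0%N m i]%N.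
  have tm' i : (i < r)%N -> (cnt t i <= nth 0%N m i)%N.
    by move=> ir; apply: (forallP tm (Ordinal ir)).
  pose m' := [tuple (nth 0 m i - cnt t i)%N | i < r].
  have m'E i : (i < r)%N -> nth 0%N m' i = (nth 0 m i - cnt t i)%N.
    by move=> ir; rewrite (nth_mktuple _ _ (Ordinal ir)).
  rewrite [RHS](_ : _ = fcoef (pser p r (c t j)) (fun i => (p * nth 0%N m' i)%N%:Z)); last first.
    apply: eq_fcoef => i ir; rewrite em// m'E// mulnBr subzn// leq_mul2l tm'//.
    by rewrite orbT.
  rewrite fcoef_pser// /c (@eq_tau _ (nth 0%N m)) => [|i ir]; last by rewrite m'E// subnK ?tm'.
  case: ifP => // _; apply: eq_fcoef => i ir.
  by rewrite m'E// subnK ?tm'// em.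
rewrite ifF; last first.
  by apply/negP => /eqP; rewrite /tau; case: pickP => // t' tt' [t't]; move: tm; rewrite -t't tt'.
apply/esym/eqP; apply: contraT => /((in_KxP _ _).1 (@in_Kx_pser _ _ _ _)).
move=> [m' /suppt em']; case/negP: tm; apply/forallP => i.
have := em' i (ltn_ord i); rewrite em// => /eqP; rewrite eqz_nat eqn_pmul2l// => /eqP ->.
by rewrite leq_addl.
Qed.

End XadicOrder.

(** * The weight Ltilde on monomials in zeta *)

(** Summation by parts: the amount by which zeta_i lowers the exponent of the next variable is
    charged to index i. *)
Lemma sum_shift r (X m c : nat -> int) :
  \sum_(i < r) X i * (m i - if nat_of_ord i is j.+1 then c j else 0) =
  \sum_(i < r) (X i * m i - if (i.+1 < r)%N then X i.+1 * c i else 0).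
Proof.
case: r => [|r]; first by rewrite !big_ord0.
under eq_bigr do rewrite mulrBr.
rewrite !sumrB; congr (_ - _); rewrite big_ord_recl mulr0 add0r big_ord_recr /= ltnn addr0.
by apply: eq_bigr => i _; rewrite ltnS ltn_ord.
Qed.

Section Weights.
Variables (r : nat) (q : r.-1.-tuple nat) (b : r.-tuple nat).
Implicit Types (a m : r.-tuple nat).

(** The weight of x_(i+1)^(1/p), that is, the coefficient of n_(i+1) in [Ltilde]. *)
Definition xweight (i : nat) : nat := (\prod_(i <= k < r.-1) qprime q b k)%N.

(** The weight of zeta_(i+1), namely [xweight i] minus q_(i+1) times [xweight i.+1]. The choice of
    q' makes this difference a product of positive numbers. *)
Definition zweight (i : nat) : nat :=
  if (i.+1 < r)%N then ((nth 0 b i.+1).+1 * xweight i.+1)%N else 1%N.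

Definition zwt (m : r.-tuple nat) : nat := (\sum_(i < r) zweight i * nth 0 m i)%N.

(* The value at i is the exponent of x_(i+1)^(1/p) in zeta^m. *)
Definition zx (m : seq nat) (i : nat) : int :=
  (nth 0%N m i)%:Z - (if i is j.+1 then (nth 0 q j * nth 0 m j)%N%:Z else 0).

Lemma zexpE m i : (i < r)%N -> nth 0 (zexp q m) i = zx m i.
Proof. by move=> ir; rewrite nth_mkseq//; case: i ir. Qed.

Lemma xweight_gt0 i : (0 < xweight i)%N.
Proof. by rewrite prodn_gt0// => k; rewrite /qprime addn1. Qed.

Lemma xweightS i : (i.+1 < r)%N ->
  xweight i = ((nth 0 q i + (nth 0 b i.+1).+1) * xweight i.+1)%N.
Proof.
by move=> ir; rewrite /xweight big_ltn /qprime ?addn1 ?addnS//; lia.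
Qed.

Lemma xweight_last : xweight r.-1 = 1%N.
Proof. by rewrite /xweight big_geq. Qed.

Lemma zweight_gt0 i : (0 < zweight i)%N.
Proof. by rewrite /zweight; case: ifP; rewrite ?muln_gt0 ?xweight_gt0. Qed.

Lemma zweight_le_xweight i : (i < r)%N -> (zweight i <= xweight i)%N.
Proof.
rewrite /zweight => ir; case: ifP => [ir'|_]; last exact: xweight_gt0.
by rewrite (xweightS ir') leq_mul2r leq_addl orbT.
Qed.

(** This converts weights into total degrees, in terms of which the procedure is queried. *)
Lemma sumn_le_zwt m : (sumn m <= zwt m)%N.
Proof. by rewrite sumn_tuple leq_sum// => i _; rewrite leq_pmull// zweight_gt0. Qed.

Lemma wform_zx m : wform (fun i => (xweight i)%:Z) r (zx m) = (zwt m)%:Z.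
Proof.
rewrite /zwt Posz_sum /wform /zx.
rewrite (sum_shift r (fun i => (xweight i)%:Z) (fun i => (nth 0%N m i)%:Z)
  (fun j => (nth 0 q j * nth 0 m j)%N%:Z)).
apply: eq_bigr => i _; rewrite /zweight; case: ifP => ir; first by rewrite (xweightS ir); lia.
have -> : nat_of_ord i = r.-1 by have := ltn_ord i; lia.
by rewrite xweight_last; lia.
Qed.

(* Since q'_i exceeds q_i by beta_(i+1) + 1, a unit of zeta_i weighs more than
   the part of zeta^beta in the later variables. *)
Lemma zweight_tail i : (i < r)%N ->
  (\sum_(i.+1 <= j < r) zweight j * nth 0 b j < zweight i)%N.
Proof.
move: {-1}(r - i.+1)%N (erefl (r - i.+1)%N) => n; elim: n i => [|n ih] i rin ir.
  by rewrite big_geq ?zweight_gt0//; lia.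
have ir' : (i.+1 < r)%N by lia.
have -> : zweight i = ((nth 0 b i.+1).+1 * xweight i.+1)%N by rewrite /zweight ir'.
(* Of the beta_(i+2) + 1 copies of [xweight i.+1], one absorbs the tail after [i.+1], by induction,
   and the others absorb the term at [i.+1]. *)
rewrite big_ltn// mulSn addnC.
rewrite -addSn leq_add//; last by rewrite mulnC leq_mul2l zweight_le_xweight// orbT.
by apply: leq_trans (zweight_le_xweight ir'); apply: ih; lia.
Qed.

Lemma lexi_tuple_first a m : ((a : r.-tuplelexi nat) <= (m : r.-tuplelexi nat))%O ->
  a = m \/ exists k : 'I_r, (tnth a k < tnth m k)%N /\
    forall i : 'I_r, (i < k)%N -> tnth a i = tnth m i.
Proof.
move=> /lexi_tupleP[k km]; have [rk|kr] := leqP r k.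
  left; apply: eq_from_tnth => i; apply/eqP.
  have ik : (i < k)%N by apply: leq_trans rk.
  by rewrite (km i (ltnW ik)).2 neq_ltn ik.
right; exists (Ordinal kr); split=> [|i ik].
  have [le_am] := km (Ordinal kr) (leqnn _); rewrite eqxx /= => ne_am.
  by rewrite ltn_neqAle ne_am.
by apply/eqP; rewrite (km i (ltnW ik)).2 neq_ltn ik.
Qed.

(** At the first difference [k], [m] has at least one unit more than [a]. By [zweight_tail] this
    unit outweighs all that [a], being bounded by [b], has in the later variables. *)
Lemma zwt_lexi a m : (forall i : 'I_r, tnth a i <= tnth b i)%N ->
  ((a : r.-tuplelexi nat) <= (m : r.-tuplelexi nat))%O -> (zwt a <= zwt m)%N.
Proof.
move=> ab /lexi_tuple_first[->//|[k [akm aim]]].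
rewrite /zwt -!(big_mkord xpredT (fun i => zweight i * nth 0 _ i)%N).
rewrite !(@big_cat_nat _ _ _ k 0 r)//=; try exact: ltnW.
rewrite leq_add//.
  rewrite leq_eqVlt; apply/orP; left; apply/eqP.
  rewrite !big_nat; apply: eq_bigr => i /andP[_ ik].
  have ir : (i < r)%N by apply: ltn_trans ik _.
  by have := aim (Ordinal ir) ik; rewrite !(tnth_nth 0%N) /= => ->.
rewrite !(@big_ltn _ _ _ k r)//.
apply: (@leq_trans (zweight k * (nth 0 a k).+1)); last first.
  by apply: leq_trans (leq_addr _ _); rewrite leq_mul2l -!tnth_nth akm orbT.
rewrite mulnS addnC leq_add2r; apply: ltnW; apply: leq_ltn_trans (zweight_tail _) => //.
rewrite !big_nat; apply: leq_sum => i /andP[_ ir]; rewrite leq_mul2l.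
by have := ab (Ordinal ir); rewrite !(tnth_nth 0%N) => ->; rewrite orbT.
Qed.

(** The map [zx] is unitriangular, hence injective one coordinate at a time. *)
Lemma zx_prefix a m k : (k <= r)%N -> (forall i, (i < k)%N -> zx a i = zx m i) ->
  forall i, (i < k)%N -> nth 0%N a i = nth 0%N m i.
Proof.
move=> kr zam; elim=> [|i ih] ik; have := zam _ ik; rewrite /zx; first by lia.
by rewrite ih; [lia|lia].
Qed.

Lemma zx_inj a m : (forall i, (i < r)%N -> zx a i = zx m i) -> a = m.
Proof.
move=> zam; apply: eq_from_tnth => i; rewrite !(tnth_nth 0%N).
exact: zx_prefix zam _ _.
Qed.

(** Unitriangularity also makes [zx] preserve the lexicographic order, so that the valuation in zeta
    gives the leading exponent in the Laurent field. *)
Lemma zx_lexi a m k : ((a : r.-tuplelexi nat) <= (m : r.-tuplelexi nat))%O ->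
  (k < r)%N -> (forall i, (i < k)%N -> zx m i = zx a i) -> zx a k <= zx m k.
Proof.
move=> am kr zma; have ma := zx_prefix (ltnW kr) zma.
have -> : (zx a k <= zx m k) = (nth 0%N a k <= nth 0%N m k)%N.
  by rewrite /zx; case: k kr {zma} ma => [|k] kr ma; rewrite ?(ma k)// lerD2r lez_nat.
have [->//|[k' []]] := lexi_tuple_first am.
rewrite !(tnth_nth 0%N) => ak' ai.
have [kk'|kk'|->] := ltngtP k k'; last exact: ltnW.
  by have := ai (Ordinal kr) kk'; rewrite !(tnth_nth 0%N) /= => ->.
by rewrite ma ?ltnn// in ak'.
Qed.

(** The exponent of x^m as a monomial in zeta, obtained by solving the unitriangular system
    [zx z = p m] from the first variable on. *)
Definition xzeta (p : nat) (m : seq nat) : nat -> nat :=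
  fix xz i := (p * nth 0 m i + (if i is j.+1 then nth 0 q j * xz j else 0))%N.

Definition xzeta_tuple (p : nat) m : r.-tuple nat := [tuple xzeta p m i | i < r].

Lemma zx_xzeta p m i : (i < r)%N ->
  zx (xzeta_tuple p m) i = (p * nth 0%N m i)%N%:Z.
Proof.
have xzE j : (j < r)%N -> nth 0%N (xzeta_tuple p m) j = xzeta p m j.
  by move=> jr; rewrite (nth_mktuple _ _ (Ordinal jr)).
case: i => [|i] ir; rewrite /zx xzE//=; first by lia.
by rewrite xzE; lia.
Qed.

Variable K : fieldType.
Implicit Types s : iter_laurent K r.

Definition zwge := @wge K (fun i => (xweight i)%:Z) r.

Lemma zwgeP k s : zwge k s <-> forall n, scoef s n != 0 -> k <= Ltilde q b n.
Proof.
have LtE n : Ltilde q b n = wform (fun i => (xweight i)%:Z) r (nth 0 n).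
  by apply: eq_bigr => i _; rewrite (tnth_nth 0).
split=> [ws n|ws e]; first by rewrite scoefE LtE; apply: ws.
rewrite fcoefE => /ws; rewrite LtE; congr (_ <= _).
by apply: eq_wform => i ir; rewrite (nth_mktuple _ _ (Ordinal ir)).
Qed.

Lemma scoef_zexp s m : scoef s (zexp q m) = fcoef s (zx m).
Proof. by rewrite scoefE; apply: eq_fcoef => i ir; rewrite zexpE. Qed.

Lemma in_KzetaP s : in_Kzeta q s <-> forall e, fcoef s e != 0 ->
  exists m : r.-tuple nat, forall i, (i < r)%N -> e i = zx m i.
Proof.
split=> [sz e|sz n].
  rewrite fcoefE => /sz[m em]; exists m => i ir.
  by rewrite -zexpE// -em (nth_mktuple _ _ (Ordinal ir)).
rewrite scoefE => /sz[m em]; exists m; apply: eq_from_tnth => i.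
by rewrite !(tnth_nth 0) em// zexpE.
Qed.

Lemma zwge_zeta k s : in_Kzeta q s ->
  (forall m, scoef s (zexp q m) != 0 -> (k <= zwt m)%N) -> zwge k%:Z s.
Proof.
move=> /in_KzetaP sz sk e se; have [m em] := sz e se.
rewrite (eq_wform _ em) wform_zx lez_nat; apply: sk.
by rewrite scoef_zexp -(eq_fcoef _ em).
Qed.

Lemma lexval_lead s a : in_Kzeta q s -> is_lexval q s a -> lead s (zx a).
Proof.
move=> /in_KzetaP sz [sa mina]; apply: leadP => [|e k se kr ea].
  by rewrite -scoef_zexp.
have [m em] := sz e se; rewrite em//; apply: zx_lexi => // [|i ik].
  by apply: mina; rewrite scoef_zexp -(eq_fcoef _ em).
by rewrite -em ?ea//; apply: ltn_trans ik _.
Qed.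

Lemma zwge_lexval s a : in_Kzeta q s -> is_lexval q s a ->
  (forall i : 'I_r, tnth a i <= tnth b i)%N -> zwge (zwt a)%:Z s.
Proof.
by move=> sz [sa mina] ab; apply: zwge_zeta => // m /mina; apply: zwt_lexi.
Qed.

End Weights.

Definition tadd r (a m : r.-tuple nat) : r.-tuple nat :=
  [tuple (tnth a i + tnth m i)%N | i < r].

Lemma zx_tadd r (q : r.-1.-tuple nat) (a m : r.-tuple nat) i : (i < r)%N ->
  zx q (tadd a m) i = zx q a i + zx q m i.
Proof.
have tE j : (j < r)%N -> nth 0%N (tadd a m) j = (nth 0 a j + nth 0 m j)%N.
  by move=> jr; rewrite (nth_mktuple _ _ (Ordinal jr)) !(tnth_nth 0%N).
case: i => [|i] ir; rewrite /zx tE//; first by lia.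
by rewrite tE; lia.
Qed.

Lemma lead_min K r (s : iter_laurent K r) e e' k : lead s e -> fcoef s e' != 0 ->
  (k < r)%N -> (forall i, (i < k)%N -> e' i = e i) -> e k <= e' k.
Proof.
elim: r s e e' k => // r ih s e e' k /= [s0 s1] se' kr ee'.
have [e0|] := ltP (e' 0%N) (e 0%N); first by rewrite s0// fcoef0 eqxx in se'.
case: k kr ee' => // k kr ee' _.
apply: (ih _ (e \o succn) (e' \o succn) k s1) => // [|i ik]; last exact: ee'.
by rewrite -(ee' 0%N).
Qed.

(** The input contains the valuations of f and g but not beta, which the program recovers as their
    sum. Leading coefficients lie in a field, so leading terms multiply to a nonzero term. *)
Lemma lexvalM (K : fieldType) r (q : r.-1.-tuple nat) (f g : iter_laurent K r)
    (a a' b : r.-tuple nat) : in_Kzeta q f -> in_Kzeta q g ->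
  is_lexval q f a -> is_lexval q g a' -> is_lexval q (f * g) b -> b = tadd a a'.
Proof.
move=> fz gz fa ga' [fgb minb].
have fg_lead := leadM (lexval_lead fz fa) (lexval_lead gz ga').
have zxD : forall i, (i < r)%N -> zx q (tadd a a') i = zx q a i + zx q a' i.
  exact: zx_tadd.
have ba : ((b : r.-tuplelexi nat) <= (tadd a a' : r.-tuplelexi nat))%O.
  by apply: minb; rewrite scoef_zexp (eq_fcoef _ zxD) lead_fcoef.
have [//|[k [bak bai]]] := lexi_tuple_first ba.
have fgzb : fcoef (f * g) (zx q b) != 0 by rewrite -scoef_zexp.
have zxk i : (i < k)%N -> zx q b i = zx q (tadd a a') i.
  move=> ik; have bE j : (j < k)%N -> nth 0%N b j = nth 0%N (tadd a a') j.
    move=> jk; have jr : (j < r)%N by apply: ltn_trans jk _.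
    by have := bai (Ordinal jr) jk; rewrite !(tnth_nth 0%N).
  by case: i ik => [|i] ik; rewrite /zx !bE//; apply: ltnW.
have := lead_min fg_lead fgzb (ltn_ord k) _; rewrite -zxD// => min_k.
have {min_k} : zx q (tadd a a') k <= zx q b k.
  by apply: min_k => i ik; rewrite zxk// zxD//; apply: ltn_trans ik _.
rewrite !(tnth_nth 0%N) in bak; rewrite /zx.
case: (nat_of_ord k) bak zxk bai (ltn_ord k) => [|j] bak zxk bai jr; first by lia.
have bE : nth 0%N b j = nth 0%N (tadd a a') j.
  by have := bai (Ordinal (ltnW jr)) (ltnSn j); rewrite !(tnth_nth 0%N).
by rewrite bE; lia.
Qed.

(** * Reduction to finitely many linear conditions *)

Section SparsePolynomials.
Variables (K : fieldType) (r : nat) (q : r.-1.-tuple nat).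
Implicit Types (l : seq (r.-tuple nat * K)) (m : r.-tuple nat).

(* A list of pairs (m, c), possibly with repeated m, stands for the sum of the
   c zeta^m. *)
Definition peval l : iter_laurent K r := \sum_(x <- l) mono r (zx q x.1) x.2.

(** Left folds, in the order in which the program computes. Like terms are never collected; [pcoef]
    adds them up when a coefficient is needed. *)
Definition pmul l1 l2 : seq (r.-tuple nat * K) :=
  foldl (fun acc x =>
    foldl (fun acc y => (tadd x.1 y.1, x.2 * y.2) :: acc) acc l2) [::] l1.

Definition pcoef l m : K :=
  foldl (fun acc x => acc + (if x.1 == m then x.2 else 0)) 0 l.

Lemma peval_nil : peval [::] = 0.
Proof. by rewrite /peval big_nil. Qed.

Lemma peval_cons x l : peval (x :: l) = mono r (zx q x.1) x.2 + peval l.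
Proof. by rewrite /peval big_cons. Qed.

Lemma peval_seq1 x : peval [:: x] = mono r (zx q x.1) x.2.
Proof. by rewrite peval_cons peval_nil addr0. Qed.

Lemma peval_mul l1 l2 : peval (pmul l1 l2) = peval l1 * peval l2.
Proof.
have mulx x acc : peval (foldl (fun acc y => (tadd x.1 y.1, x.2 * y.2) :: acc) acc l2) =
    peval acc + mono r (zx q x.1) x.2 * peval l2.
  elim: l2 acc => [|y l2 ih] acc /=; first by rewrite peval_nil mulr0 addr0.
  rewrite ih !peval_cons mulrDr addrCA addrA monoM; congr (_ + _ + _).
  by apply: eq_mono => i ir /=; rewrite zx_tadd.
rewrite -[RHS]add0r -[X in X + _]peval_nil /pmul.

elim: l1 [::] => [|x l1 ih] acc /=; first by rewrite peval_nil mul0r addr0.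
by rewrite ih mulx peval_cons mulrDl addrA.
Qed.

Lemma peval_iter_mul l l0 n : peval (iter n (pmul l) l0) = peval l ^+ n * peval l0.
Proof. by elim: n => [|n ih]; rewrite ?mul1r//= peval_mul ih mulrA -exprS. Qed.

Lemma fcoef_peval l m : fcoef (peval l) (zx q m) = pcoef l m.
Proof.
suff foldE acc : foldl (fun acc x => acc + (if x.1 == m then x.2 else 0)) acc l =
    acc + fcoef (peval l) (zx q m) by rewrite /pcoef foldE add0r.
elim: l acc => [|x l ih] acc /=; first by rewrite peval_nil fcoef0 addr0.
rewrite ih peval_cons fcoefD addrA; congr (acc + _ + _).
case: eqP => [->|xm]; first by rewrite mono_fcoef.
by apply/esym/eqP; apply: contraT => /fcoef_mono_neq0 /zx_inj /esym.
Qed.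

Lemma peval_supp l e : fcoef (peval l) e != 0 ->
  exists m, forall i, (i < r)%N -> e i = zx q m i.
Proof.
elim: l => [|x l ih]; first by rewrite peval_nil fcoef0 eqxx.
rewrite peval_cons fcoefD.
have [->|/fcoef_mono_neq0 ex _] := eqVneq (fcoef (mono r (zx q x.1) x.2) e) 0.
  by rewrite add0r.
by exists x.1.
Qed.

End SparsePolynomials.

Section IndexSet.
Variables (r d N : nat).

Lemma index_inj (u v : index_set r d N) :
  index_x u = index_x v -> index_y u = index_y v -> u = v.
Proof.
move=> xuv yuv; apply: val_inj; apply: injective_projections; last exact: val_inj.
by apply: val_inj; apply: (inj_map val_inj); apply: (congr1 val xuv).
Qed.

Lemma sumn_index_x (u : index_set r d N) : (sumn (index_x u) <= N)%N.
Proof. by have := valP u; rewrite sumnE /= big_map. Qed.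

Lemma index_y_le (u : index_set r d N) : (index_y u <= d)%N.
Proof. by rewrite -ltnS ltn_ord. Qed.

Lemma index_surj (m : r.-tuple nat) j : (sumn m <= N)%N -> (j <= d)%N ->
  exists u : index_set r d N, index_x u = m /\ index_y u = j.
Proof.
move=> mN jd; have mi i : (tnth m i <= N)%N.
  apply: leq_trans mN; rewrite sumn_tuple (bigD1 i)//= -tnth_nth.
  exact: leq_addr.
pose u1 := [tuple inord (tnth m i) : 'I_N.+1 | i < r].
have u1E i : tnth u1 i = tnth m i :> nat by rewrite tnth_mktuple inordK// ltnS.
have uP : (\sum_(k <- (u1, (inord j : 'I_d.+1)).1) k <= N)%N.
  apply: leq_trans mN; rewrite big_tuple /= sumn_tuple; apply: leq_sum => i _.
  by rewrite u1E (tnth_nth 0%N).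
exists (exist _ (u1, inord j) uP); split; last by rewrite /index_y /= inordK.
by apply: eq_from_tnth => i; rewrite tnth_map u1E.
Qed.

End IndexSet.

Section LinearConditions.
Variables (K : fieldType) (r d N p : nat) (q : r.-1.-tuple nat).

Definition table_of (s : seq (r.-tuple nat)) (h : iter_laurent K r) :
    seq (r.-tuple nat * K) := [seq (m, scoef h (zexp q m)) | m <- s].

(* x^i f^j g^(d-j), with f and g replaced by tables. *)
Definition xfg (tf tg : seq (r.-tuple nat * K)) (i : r.-tuple nat) (j : nat) :=
  iter (d - j) (pmul tg) (iter j (pmul tf) [:: (xzeta_tuple q p i, 1)]).

(** The coefficient of zeta^m in the truncated g^d Q(y0), as a linear form in the coefficients of
    Q. *)
Definition lincond (tf tg : seq (r.-tuple nat * K)) (m : r.-tuple nat)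
    (v : {ffun index_set r d N -> K^o}) : K^o :=
  \sum_(u : index_set r d N)
    v u * pcoef (xfg tf tg (index_x u) (index_y u)) m.

Lemma lincond_is_linear tf tg m : linear (lincond tf tg m).
Proof.
move=> a v w; rewrite /lincond scaler_sumr -big_split /=; apply: eq_bigr => u _.
by rewrite !ffunE mulrDl -mulrA.
Qed.

HB.instance Definition _ tf tg m := GRing.isLinear.Build K _ K^o *:%R
  (lincond tf tg m) (lincond_is_linear tf tg m).

(** Coordinates are linear forms on the same footing as the conditions, so that a single list of
    forms describes a row of the elimination. *)
Definition coordinate (u : index_set r d N) (v : {ffun index_set r d N -> K^o}) : K^o :=
  v u.

Lemma coordinate_is_linear u : linear (coordinate u).
Proof. by move=> a v w; rewrite /coordinate !ffunE. Qed.

HB.instance Definition _ u := GRing.isLinear.Build K _ K^o *:%R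
  (coordinate u) (coordinate_is_linear u).

End LinearConditions.

(** * Truncation modulo elements of large weight *)

Section Truncation.
Variables (K : fieldType) (r d nu0 p : nat) (q : r.-1.-tuple nat).
Variables (f g : iter_laurent K r) (valf valg : r.-tuple nat) (nu : nat).
Hypothesis p_gt0 : (0 < p)%N.
Hypotheses (fz : in_Kzeta q f) (gz : in_Kzeta q g).
Hypotheses (g_val : is_lexval q g valg).

Let b := tadd valf valg.
Definition bound : nat := (nu + d * zwt q b valg)%N.
(** At least [bound], so that truncation in degree [N] loses nothing below that weight, and at least
    [nu0], as a parametric description demands. *)
Let N := (nu0 + bound)%N.
Variables sf sg : seq (r.-tuple nat).
Hypotheses (uniq_sf : uniq sf) (uniq_sg : uniq sg).
Hypothesis sfP : sf =i [pred m : r.-tuple nat | (sumn m <= N)%N].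
Hypothesis sgP : sg =i [pred m : r.-tuple nat | (sumn m <= N)%N].
Local Notation zwge := (@zwge r q b K).

Let tf := table_of q sf f.
Let tg := table_of q sg g.

(** Congruence modulo weight at least [bound]. Requiring nonnegative weights makes it compatible
    with products. *)
Let cg (s t : iter_laurent K r) :=
  [/\ zwge 0 s, zwge 0 t & zwge bound%:Z (s - t)].

Let cgM s t s' t' : cg s t -> cg s' t' -> cg (s * s') (t * t').
Proof.
move=> [s0 t0 st] [s0' t0' st']; split; do ?by rewrite -[0]addr0; apply: wgeM.
have -> : s * s' - t * t' = (s - t) * s' + t * (s' - t').
  by rewrite mulrBl mulrBr addrA subrK.
by apply: wgeD; [rewrite -[bound%:Z]addr0|rewrite -[bound%:Z]add0r]; apply: wgeM.
Qed.

Let cgX s t n : cg s t -> cg (s ^+ n) (t ^+ n).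
Proof.
move=> st; elim: n => [|n ih]; last by rewrite !exprS; apply: cgM.
by rewrite !expr0; split; [exact: wge1|exact: wge1|rewrite subrr; exact: wge0].
Qed.

Let fcoef_table s (h : iter_laurent K r) (m : r.-tuple nat) : uniq s ->
  fcoef (peval q (table_of q s h)) (zx q m) = if m \in s then scoef h (zexp q m) else 0.
Proof.
elim: s => [|x s ih] /=; first by rewrite peval_nil fcoef0.
move=> /andP[xs us]; rewrite peval_cons fcoefD ih// in_cons.
have [->|xm] := eqVneq m x.
  by rewrite mono_fcoef (negbTE xs) addr0.
rewrite (_ : fcoef (mono _ _ _) _ = 0) ?add0r//.
by apply/eqP; apply: contraT => /fcoef_mono_neq0 /zx_inj /eqP; rewrite (negbTE xm).
Qed.

Let cg_table s (h : iter_laurent K r) : in_Kzeta q h -> uniq s ->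
  s =i [pred m : r.-tuple nat | (sumn m <= N)%N] -> cg h (peval q (table_of q s h)).
Proof.
move=> hz us sP; split; first exact: zwge_zeta.
  move=> e /peval_supp[m em].
  by rewrite (eq_wform _ em) wform_zx.
move=> e; rewrite fcoefB => he.
have [m em] : exists m : r.-tuple nat, forall i, (i < r)%N -> e i = zx q m i.
  have [h0|/((in_KzetaP _ _).1 hz)//] := eqVneq (fcoef h e) 0.
  by move: he; rewrite h0 sub0r oppr_eq0 => /peval_supp.
move: he; rewrite !(eq_fcoef _ em) (eq_wform _ em) wform_zx fcoef_table// sP inE.
rewrite lez_nat scoef_zexp; case: leqP => [_|Nm _]; first by rewrite subrr eqxx.
apply: leq_trans (sumn_le_zwt q b m); apply: leq_trans (ltnW Nm).
exact: leq_addl.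
Qed.

(** The part of degree at most [N] of the coefficient of y^j, written in monomials of zeta in order
    to match the terms of [lincond]. *)
Let xcoef (Q : {poly iter_laurent K r}) j : iter_laurent K r :=
  \sum_(u : index_set r d N | index_y u == j)
    mono r (fun=> 0) (xycoef p Q (index_x u) j) *
    mono r (zx q (xzeta_tuple q p (index_x u))) 1.

Let fcoef_xcoef Q j e : fcoef (xcoef Q j) e =
  \sum_(u : index_set r d N | index_y u == j)
    fcoef (mono r (fun i => (p * nth 0%N (index_x u) i)%N%:Z)
      (xycoef p Q (index_x u) j)) e.
Proof.
rewrite fcoef_sum; apply: eq_bigr => u _; rewrite monoM mulr1.
by congr fcoef; apply: eq_mono => i ir; rewrite add0r zx_xzeta.
Qed.

Let wge_px (m : r.-tuple nat) :
  (sumn m)%:Z <= wform (fun i => (xweight q b i)%:Z) r (fun i => (p * nth 0%N m i)%N%:Z).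
Proof.
rewrite sumn_tuple Posz_sum; apply: ler_sum => i _.
by rewrite -PoszM lez_nat mulnA leq_pmull// muln_gt0 xweight_gt0.
Qed.

Let cg_xcoef (Q : {poly iter_laurent K r}) j : (j <= d)%N -> in_Kx_y p Q ->
  cg Q`_j (xcoef Q j).
Proof.
move=> jd Qx; have Qsupp := (in_KxP _ _).1 (Qx j); split.
- exact: wge_in_Kx.
- move=> e; rewrite fcoef_xcoef => Qe.
  have [u _] : exists2 u : index_set r d N, index_y u == j &
      fcoef (mono r (fun i => (p * nth 0%N (index_x u) i)%N%:Z)
        (xycoef p Q (index_x u) j)) e != 0.
    apply: contrapT => Q0; case/negP: Qe; apply/eqP; apply: big1 => u uj.
    by apply/eqP; apply: contraT => ue; case: Q0; exists u.
  move=> /fcoef_mono_neq0 eu; rewrite (eq_wform _ eu).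
  by apply: le_trans (wge_px _).
move=> e; rewrite fcoefB => Qe.
have [m em] : exists m : r.-tuple nat, forall i, (i < r)%N -> e i = (p * nth 0%N m i)%N%:Z.
  have [h0|/Qsupp//] := eqVneq (fcoef Q`_j e) 0.
  apply: contrapT => em; case/negP: Qe; rewrite h0 sub0r oppr_eq0; apply/eqP.
  rewrite fcoef_xcoef big1// => u _; apply/eqP; apply: contraT => /fcoef_mono_neq0 eu.
  by case: em; exists (index_x u).
rewrite (eq_wform _ em); apply: le_trans (wge_px m); rewrite lez_nat.
(* A monomial of degree less than [N] has an index, and its coefficient cancels in the
   difference. *)
apply: leq_trans (leq_addl nu0 _) _; rewrite -/N; rewrite leqNgt; apply/negP => mN.
have [u [um uj]] := index_surj (ltnW mN) jd.
case/negP: Qe; rewrite subr_eq0 !(eq_fcoef _ em) fcoef_xcoef; apply/eqP.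
rewrite (bigD1 u) ?uj// um mono_fcoef -xycoefE big1 => [|v /andP[/eqP vj vu]].
  by rewrite [RHS]addr0.
apply/eqP; apply: contraT => /fcoef_mono_neq0 mv; case/eqP: vu.
apply: index_inj; rewrite ?vj ?uj// um; apply: eq_from_tnth => i.
have := mv i (ltn_ord i); rewrite !(tnth_nth 0%N) => /eqP.
by rewrite eqz_nat eqn_pmul2l// => /eqP.
Qed.

(** Multiplication by g^d shifts the filtration by exactly d w(g): g has weight at least w(g), its
    valuation being below [b] componentwise, and 1/g has weight at least -w(g). *)
Let zwge_clear_denominators (Q : {poly iter_laurent K r}) : g != 0 ->
  (zwge nu%:Z Q.[f / g] <-> zwge bound%:Z (g ^+ d * Q.[f / g])).
Proof.
move=> g0; have gW : zwge (zwt q b valg)%:Z g.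
  apply: zwge_lexval => // i; by rewrite tnth_mktuple leq_addl.
have gWV : zwge (- (zwt q b valg)%:Z) g^-1.
  have := @wgeV _ (fun i => (xweight q b i)%:Z) _ _ _ (lexval_lead gz g_val).
  by rewrite wform_zx; apply.
have boundE : bound%:Z = (zwt q b valg)%:Z *+ d + nu%:Z.
  by rewrite /bound PoszD PoszM; lia.
split=> [Qnu|Qnu]; first by rewrite boundE; apply: wgeM => //; apply: wgeX.
have -> : nu%:Z = (- (zwt q b valg)%:Z) *+ d + bound%:Z by rewrite boundE; lia.
have -> : Q.[f / g] = g^-1 ^+ d * (g ^+ d * Q.[f / g]).
  by rewrite mulrA -exprMn mulVf// expr1n mul1r.
by apply: wgeM => //; apply: wgeX.
Qed.

Lemma Qset_cond_lincond (Q : {poly iter_laurent K r}) : g != 0 ->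
  in_Kx_y p Q -> (size Q <= d.+1)%N ->
  (forall n, scoef Q.[f / g] n != 0 -> nu%:Z <= Ltilde q b n) <->
  (forall m, m \in sf -> (zwt q b m < bound)%N ->
     lincond p q tf tg m
       ([ffun u => xycoef p Q (index_x u) (index_y u)] : {ffun index_set r d N -> K^o}) = 0).
Proof.
move=> g0 Qx sQ; rewrite -zwgeP -/zwge zwge_clear_denominators//.
set F := peval q tf; set G := peval q tg.
have -> : g ^+ d * Q.[f / g] = \sum_(j < d.+1) Q`_j * f ^+ j * g ^+ (d - j).
  rewrite (horner_coef_wide _ sQ) mulr_sumr; apply: eq_bigr => j _.
  have jd : (j <= d)%N by rewrite -ltnS.
  rewrite expr_div_n mulrCA -mulrA; congr (_ * _); rewrite mulrCA; congr (_ * _).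
  by rewrite -[in g ^+ d](subnK jd) exprD mulfK// expf_neq0.
set S := \sum_(j < d.+1) _.
pose c : {ffun index_set r d N -> K^o} :=
  [ffun u : index_set r d N => xycoef p Q (index_x u) (index_y u)].
(* [S'] is g^d Q(y0) with Q, f and g truncated; it is congruent to [S] and its coefficients are the
   forms [lincond]. *)
pose S' := \sum_(u : index_set r d N)
  @mono K r (fun=> 0) (c u) * peval q (xfg d p q tf tg (index_x u) (index_y u)).
have SS' : zwge bound%:Z (S - S').
  have -> : S' = \sum_(j < d.+1) xcoef Q j * F ^+ j * G ^+ (d - j).
    rewrite /S' (partition_big (fun u : index_set r d N => (val u).2) xpredT)//=.
    apply: eq_bigr => j _; rewrite !mulr_suml; apply: eq_bigr => u /eqP uj.
    rewrite /c ffunE /xfg !peval_iter_mul /index_y uj -!mulrA; congr (_ * _).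
    by rewrite peval_seq1 mulrA mulrC [X in _ * X]mulrC.
  rewrite -sumrB; apply: wge_sum => j _.
  have jd : (j <= d)%N by rewrite -ltnS.
  have [_ _ //] : cg (Q`_j * f ^+ j * g ^+ (d - j)) (xcoef Q j * F ^+ j * G ^+ (d - j)).
  by do ![apply: cgM|apply: cgX]; [apply: cg_xcoef|apply: cg_table|apply: cg_table].
have fS' (m : r.-tuple nat) : fcoef S' (zx q m) = lincond p q tf tg m c.
  rewrite fcoef_sum; apply: eq_bigr => u _; rewrite fcoefMmono; congr (_ * _).
  by rewrite -(fcoef_peval q); apply: eq_fcoef => i _; rewrite subr0.
have -> : zwge bound%:Z S <-> zwge bound%:Z S'.
  split=> wS; first by rewrite -[S'](subKr S); apply: wgeB.
  by rewrite -[S](subrK S'); apply: wgeD.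
split=> [wS' m _ mb|lin e S'e].
  apply/eqP; apply: contraT => lm; have := wS' (zx q m).
  by rewrite fS' wform_zx lez_nat leqNgt mb => /(_ lm).
have [m em] : exists m : r.-tuple nat, forall i, (i < r)%N -> e i = zx q m i.
  apply: contrapT => em; case/negP: S'e; apply/eqP.
  rewrite fcoef_sum big1// => u _; rewrite fcoefMmono.
  apply/eqP; apply: contraT; rewrite mulf_eq0 negb_or => /andP[_ /peval_supp[m em']].
  by case: em; exists m => i /em'; rewrite subr0.
rewrite (eq_wform _ em) wform_zx lez_nat leqNgt; apply/negP => mb.
(* A monomial of weight below [bound] has degree at most [N], hence its condition is listed. *)
case/negP: S'e; rewrite (eq_fcoef _ em) fS' lin// sfP inE.
apply: leq_trans (sumn_le_zwt q b m) _; apply: leq_trans (ltnW mb) _.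
exact: leq_addl.
Qed.

End Truncation.

(** * Elimination *)

Section Elimination.
Variables (K : fieldType) (V : vectType K).
Implicit Types (phi : {linear V -> K^o}) (p v : V) (S R : seq V).

Definition reduce (phi : V -> K^o) p v : V := v - (phi v / phi p) *: p.

(* The first component of the state is empty until a pivot is found. *)
Definition elim_step (phi : V -> K^o) (st : seq V * seq V) v : seq V * seq V :=
  if st.1 is p :: _ then (st.1, reduce phi p v :: st.2)
  else if phi v == 0 then ([::], v :: st.2) else ([:: v], st.2).

(** The rows form a basis of the solutions found so far. A new condition corrects them by a pivot,
    which is then discarded. *)
Definition elim_rows (phi : V -> K^o) R : seq V :=
  (foldl (elim_step phi) ([::], [::]) R).2.

Lemma reduce_is_linear phi p : linear (reduce phi p).
Proof.
move=> a u v; rewrite /reduce linearP [a *: phi u]mulrC mulrDl scalerDl opprD.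
by rewrite scalerBr scalerA addrACA mulrC mulrA.
Qed.

HB.instance Definition _ phi p :=
  GRing.isLinear.Build K V V *:%R (reduce phi p) (@reduce_is_linear phi p).

(** [reduce phi p] projects along [p] onto the kernel of [phi]: a vector a p + w of the kernel is
    the projection of w. *)
Lemma reduce_span phi p S v : phi p != 0 ->
  (v \in <<[seq reduce phi p s | s <- S]>>%VS) = (v \in <<p :: S>>%VS) && (phi v == 0).
Proof.
move=> p0; have rhoE : [seq reduce phi p s | s <- S] = [seq linfun (reduce phi p) s | s <- S].
  by apply: eq_map => s; rewrite lfunE.
have phi_rho w : phi (reduce phi p w) = 0.
  by rewrite /reduce linearB linearZ /= [_ *: _]divfK// subrr.
rewrite rhoE -limg_span span_cons; apply/memv_imgP/andP => [[w wS ->]|[]].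
  rewrite lfunE phi_rho eqxx; split=> //; apply: rpredB.
    by apply: subvP wS; apply: addvSr.
  by apply/rpredZ/(subvP (addvSl _ _))/memv_line.
move=> /memv_addP[_ /vlineP[a ->] [w wS ->]] /eqP phi0; exists w => //.
have phiw : phi w = - (a * phi p).
  by apply/eqP; rewrite -addr_eq0 addrC -[a * _]/(a *: phi p) -linearZ -linearD phi0.
by rewrite lfunE /= /reduce phiw mulNr mulfK// scaleNr opprK addrC.
Qed.

(** A dimension count: together with [p], the reduced vectors still span everything that [p :: S]
    spans. *)
Lemma reduce_free phi p S : phi p != 0 -> free (p :: S) ->
  free [seq reduce phi p s | s <- S].
Proof.
move=> p0; rewrite /free => /eqP dimS; rewrite eqn_leq dim_span size_map /=.
rewrite -ltnS -[(size S).+1]/(size (p :: S)) -dimS.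
suff /dimvS/leq_trans : (<<p :: S>> <= <[p]> + <<[seq reduce phi p s | s <- S]>>)%VS.
  apply; apply: leq_trans (dimv_add_leqif _ _) _ => /=.
  by rewrite -add1n leq_add2r dim_vline leq_b1.
apply/subvP => v vS.
have -> : v = (phi v / phi p) *: p + reduce phi p v by rewrite addrC subrK.
rewrite memv_add ?rpredZ ?memv_line// reduce_span//; apply/andP; split.
  by rewrite rpredB ?rpredZ// memv_span// mem_head.
by rewrite /reduce linearB linearZ /= [_ *: _]divfK// subrr.
Qed.

Lemma elim_rows_free_span phi R : free R ->
  free (elim_rows phi R) /\
  forall v, (v \in <<elim_rows phi R>>%VS) = (v \in <<R>>%VS) && (phi v == 0).
Proof.
have pivotE p S out : (foldl (elim_step phi) ([:: p], out) S).2 =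
    rev (map (reduce phi p) S) ++ out.
  elim: S out => //= v S ih out.
  by rewrite ih rev_cons cat_rcons.
suff main out : all (fun v => phi v == 0) out -> free (out ++ R) ->
    free (foldl (elim_step phi) ([::], out) R).2 /\
    forall v, (v \in <<(foldl (elim_step phi) ([::], out) R).2>>%VS) =
      (v \in <<out ++ R>>%VS) && (phi v == 0) by exact: (main [::]).
elim: R out => [|r R ih] out out0 freeR.
  rewrite cats0 /= in freeR *; split=> // v; have [vout|//] := boolP (v \in _).
  rewrite /= (@coord_span _ _ _ (in_tuple out) _ vout) linear_sum big1 ?eqxx// => i _.
  have /eqP phi0 := allP out0 _ (mem_nth 0 (ltn_ord i)).
  by rewrite linearZ /= phi0 scaler0.
have outrR : perm_eq (out ++ r :: R) (r :: out ++ R) by rewrite -cat1s perm_catCA.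
have spanE := eq_span (perm_mem outrR).
rewrite /= /elim_step /=; case: eqP => [r0|/eqP r0].
  have [||fr sp] := ih (r :: out); rewrite /= ?r0 ?eqxx// ?(perm_free outrR)//.
    by rewrite -(perm_free outrR).
  by split=> // v; rewrite sp spanE.
rewrite pivotE; set res := _ ++ out.
(* The rows passed before the pivot lie in the kernel, so [reduce] fixes them, and the result is a
   reduction of all rows except the pivot. *)
have resE : perm_eq res [seq reduce phi r s | s <- out ++ R].
  rewrite map_cat perm_catC; apply: perm_cat; last by rewrite perm_rev.
  rewrite map_id_in// => v vout; rewrite /reduce (eqP (allP out0 v vout)).
  by rewrite mul0r scale0r subr0.
rewrite (perm_free resE) (eq_span (perm_mem resE)) spanE; split.
  by apply: reduce_free => //; rewrite -(perm_free outrR).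
by move=> v; apply: reduce_span.
Qed.

Lemma elim_iter_free_span (I : eqType) (phi : I -> {linear V -> K^o}) (s : seq I) R :
  free R ->
  let R' := foldl (fun R i => elim_rows (phi i) R) R s in
  free R' /\ forall v, v \in <<R'>>%VS <->
    v \in <<R>>%VS /\ (forall i, i \in s -> phi i v = 0).
Proof.
elim: s R => [|i s ih] R freeR /=; first by split=> // v; split=> [|[]].
have [free1 span1] := elim_rows_free_span (phi i) freeR.
have [free2 span2] := ih _ free1; split=> // v; rewrite span2 span1.
split=> [[/andP[vR /eqP v0] vs]|[vR vs]].
  by split=> // j; rewrite in_cons => /orP[/eqP->|/vs].
split=> [|j js]; first by rewrite vR vs ?mem_head ?eqxx.
by rewrite vs// in_cons js orbT.
Qed.

End Elimination.

(** * Programs *)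

(* Programs below are written with de Bruijn indices: the value on which they
   run is an environment VCons x0 (VCons x1 ...), and [PVar n] is x_n. *)
Fixpoint PVar (n : nat) : prog := if n is n'.+1 then PSeq PCdr (PVar n') else PCar.

Fixpoint PUp (n : nat) (a : prog) : prog := if n is n'.+1 then PSeq PCdr (PUp n' a) else a.

Definition PLet (a b : prog) : prog := PSeq (PCons a PId) b.

Definition PBin (op a b : prog) : prog := PSeq (PCons a b) op.

Definition PHead (a : prog) : prog := PSeq a PCar.

Definition PTail (a : prog) : prog := PSeq a PCdr.

Definition PNonNil (a : prog) : prog := PSeq a (PIf PIsNil (PNat 0) (PNat 1)).

(* [s] runs in the environment extended with the current elements of both lists
   and the accumulator. *)
Definition PFold2 (l1 l2 i s : prog) : prog :=
  PSeq (PCons l1 (PCons l2 (PCons i PId)))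
  (PSeq (PWhile (PNonNil (PVar 0))
    (PCons (PTail (PVar 0)) (PCons (PTail (PVar 1)) (PCons
      (PSeq (PCons (PHead (PVar 0)) (PCons (PHead (PVar 1)) (PUp 2 PId))) s)
      (PUp 3 PId)))))
  (PVar 2)).

Definition PFold (l i s : prog) : prog := PFold2 l l i (PUp 1 s).

Definition PRev (l : prog) : prog := PFold l PNil (PCons (PVar 0) (PVar 1)).

Definition PMap (l a : prog) : prog :=
  PRev (PFold l PNil (PCons (PSeq (PCons (PVar 0) (PUp 2 PId)) a) (PVar 1))).

Definition PMap2 (l1 l2 a : prog) : prog :=
  PRev (PFold2 l1 l2 PNil
    (PCons (PSeq (PCons (PVar 0) (PCons (PVar 1) (PUp 3 PId))) a) (PVar 2))).

Definition PIota (n : prog) : prog :=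
  PSeq (PCons n PNil)
  (PSeq (PWhile (PVar 0)
    (PCons (PBin PSub (PVar 0) (PNat 1))
      (PCons (PBin PSub (PVar 0) (PNat 1)) (PUp 1 PId))))
  PCdr).

Definition PIter (n i s : prog) : prog := PFold (PIota n) i (PUp 1 s).

(** Truncated subtraction in both directions adds up to a distance, which for lists of the same
    length is zero only if they agree. *)
Definition PEqNats (l1 l2 : prog) : prog :=
  PIf (PFold2 l1 l2 (PNat 0) (PBin PAdd (PVar 2)
        (PBin PAdd (PBin PSub (PVar 0) (PVar 1)) (PBin PSub (PVar 1) (PVar 0)))))
    (PNat 0) (PNat 1).

Definition PAddNats (l1 l2 : prog) : prog :=
  PMap2 l1 l2 (PBin PAdd (PVar 0) (PVar 1)).

Definition PDot (l1 l2 : prog) : prog :=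
  PFold2 l1 l2 (PNat 0) (PBin PAdd (PVar 2) (PBin PMul (PVar 0) (PVar 1))).

(** The guard waits until the environment is known. Tests, loops and inverses, whose rule depends on
    values, are treated separately. *)
Ltac run_step :=
  match goal with
  | |- run _ _ ?u _ => tryif is_evar u then fail else idtac
  end;
  lazymatch goal with
  | |- run _ (PVar _) _ _ => progress cbn [PVar]
  | |- run _ (PUp _ _) _ _ => progress cbn [PUp]
  | |- run _ (PLet _ _) _ _ => eapply run_seq
  | |- run _ (PBin _ _ _) _ _ => eapply run_seq
  | |- run _ (PHead _) _ _ => eapply run_seq
  | |- run _ (PTail _) _ _ => eapply run_seq
  | |- run _ (PSeq _ _) _ _ => eapply run_seq
  | |- run _ (PCons _ _) _ _ => eapply run_cons
  | |- run _ PId _ _ => eapply run_id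
  | |- run _ PNil _ _ => eapply run_nil
  | |- run _ PCar _ _ => eapply run_car
  | |- run _ PCdr _ _ => eapply run_cdr
  | |- run _ (PNat _) _ _ => eapply run_nat
  | |- run _ PAdd _ _ => eapply run_add
  | |- run _ PSub _ _ => eapply run_sub
  | |- run _ PMul _ _ => eapply run_mul
  | |- run _ PElt0 _ _ => eapply run_elt0
  | |- run _ PElt1 _ _ => eapply run_elt1
  | |- run _ PEltAdd _ _ => eapply run_eltadd
  | |- run _ PEltOpp _ _ => eapply run_eltopp
  | |- run _ PEltMul _ _ => eapply run_eltmul
  | |- run _ PEltIs0 _ _ => eapply run_eltis0
  | |- run _ PAsk _ _ => eapply run_ask
  end.
Ltac run_steps := repeat run_step.

Section Programs.
Variables (K : fieldType) (ask : nat -> val_of K).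
Implicit Types (e u v w : val_of K).
Local Notation run := (@run K ask).
Local Notation vlist := (@vlist K).
Local Notation vnats := (@vnats K).

Lemma run_eq a u v w : run a u v -> v = w -> run a u w.
Proof. by move=> av <-. Qed.

Lemma run_let a b u v w : run a u v -> run b (VCons v u) w -> run (PLet a b) u w.
Proof. by move=> av bw; run_steps; eassumption. Qed.

Lemma run_if (b : bool) c a1 a2 u v : run c u (VNat b) ->
  (b -> run a1 u v) -> (~~ b -> run a2 u v) -> run (PIf c a1 a2) u v.
Proof.
case: b => cb r1 r2; first exact: run_if_true cb (r1 isT).
exact: run_if_false cb (r2 isT).
Qed.

(* The encoding of the accumulator may depend on the elements still to come. *)
Lemma run_fold2_dep (I T : Type) (X Y : I -> val_of K) (E : seq I -> T -> val_of K)
    (F : T -> I -> T) l1 l2 i s e (xs : seq I) t :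
  run l1 e (vlist [seq X x | x <- xs]) -> run l2 e (vlist [seq Y x | x <- xs]) ->
  run i e (E xs t) ->
  (forall t x xs, run s (VCons (X x) (VCons (Y x) (VCons (E (x :: xs) t) e))) (E xs (F t x))) ->
  run (PFold2 l1 l2 i s) e (E [::] (foldl F t xs)).
Proof.
move=> run1 run2 runi runs.
pose st xs t := VCons (vlist [seq X x | x <- xs])
  (VCons (vlist [seq Y x | x <- xs]) (VCons (E xs t) e)).
suff loop : run (PWhile (PNonNil (PVar 0))
    (PCons (PTail (PVar 0)) (PCons (PTail (PVar 1)) (PCons
      (PSeq (PCons (PHead (PVar 0)) (PCons (PHead (PVar 1)) (PUp 2 PId))) s)
      (PUp 3 PId))))) (st xs t) (st [::] (foldl F t xs)).
  by apply: run_seq (run_seq loop _); run_steps; eassumption.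
elim: xs t {run1 run2 runi} => [|x xs ih] t.
  apply: run_while_stop; apply: run_seq; first by run_steps.
  by apply: run_if_true; [apply: run_isnil_nil|apply: run_nat].
apply: run_while_step (ih _).
  apply: run_seq; first by run_steps.
  by apply: run_if_false; [apply: run_isnil_cons|apply: run_nat].
by run_steps; apply: runs.
Qed.

Lemma run_fold2 (I T : Type) (X Y : I -> val_of K) (E : T -> val_of K)
    (F : T -> I -> T) l1 l2 i s e (xs : seq I) t :
  run l1 e (vlist [seq X x | x <- xs]) -> run l2 e (vlist [seq Y x | x <- xs]) ->
  run i e (E t) ->
  (forall t x, run s (VCons (X x) (VCons (Y x) (VCons (E t) e))) (E (F t x))) ->
  run (PFold2 l1 l2 i s) e (E (foldl F t xs)).
Proof. by move=> r1 r2 ri rs; apply: (run_fold2_dep (E := fun=> E) r1 r2). Qed.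

Lemma run_fold_dep (I T : Type) (X : I -> val_of K) (E : seq I -> T -> val_of K)
    (F : T -> I -> T) l i s e (xs : seq I) t :
  run l e (vlist [seq X x | x <- xs]) -> run i e (E xs t) ->
  (forall t x xs, run s (VCons (X x) (VCons (E (x :: xs) t) e)) (E xs (F t x))) ->
  run (PFold l i s) e (E [::] (foldl F t xs)).
Proof.
move=> rl ri rs; apply: (run_fold2_dep rl rl ri) => t' x xs'.
by run_steps; apply: rs.
Qed.

Lemma run_fold (I T : Type) (X : I -> val_of K) (E : T -> val_of K)
    (F : T -> I -> T) l i s e (xs : seq I) t :
  run l e (vlist [seq X x | x <- xs]) -> run i e (E t) ->
  (forall t x, run s (VCons (X x) (VCons (E t) e)) (E (F t x))) ->
  run (PFold l i s) e (E (foldl F t xs)).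
Proof. by move=> rl ri rs; apply: (run_fold_dep (E := fun=> E) rl). Qed.

Lemma foldl_consE (I J : Type) (h : I -> J) (xs : seq I) acc :
  foldl (fun acc x => h x :: acc) acc xs = rev (map h xs) ++ acc.
Proof. by elim: xs acc => //= x xs ih acc; rewrite ih rev_cons cat_rcons. Qed.

Lemma run_rev (I : Type) (X : I -> val_of K) l e xs :
  run l e (vlist [seq X x | x <- xs]) -> run (PRev l) e (vlist [seq X x | x <- rev xs]).
Proof.
move=> rl; have -> : rev xs = foldl (fun acc x => x :: acc) [::] xs.
  by rewrite foldl_consE map_id cats0.
by apply: (run_fold (E := fun acc => vlist [seq X x | x <- acc]) rl) => [|t x]; run_steps.
Qed.

Lemma run_map (I : Type) (X Y : I -> val_of K) l a e xs :
  run l e (vlist [seq X x | x <- xs]) -> (forall x, run a (VCons (X x) e) (Y x)) ->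
  run (PMap l a) e (vlist [seq Y x | x <- xs]).
Proof.
move=> rl ra; rewrite -[xs in map Y xs]revK; apply: run_rev.
have -> : rev xs = foldl (fun acc x => x :: acc) [::] xs.
  by rewrite foldl_consE map_id cats0.
apply: (run_fold (E := fun acc => vlist [seq Y x | x <- acc]) rl) => [|t x]; run_steps.
exact: ra.
Qed.

Lemma run_map2 (I : Type) (X Y Z : I -> val_of K) l1 l2 a e xs :
  run l1 e (vlist [seq X x | x <- xs]) -> run l2 e (vlist [seq Y x | x <- xs]) ->
  (forall x, run a (VCons (X x) (VCons (Y x) e)) (Z x)) ->
  run (PMap2 l1 l2 a) e (vlist [seq Z x | x <- xs]).
Proof.
move=> r1 r2 ra; rewrite -[xs in map Z xs]revK; apply: run_rev.
have -> : rev xs = foldl (fun acc x => x :: acc) [::] xs.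
  by rewrite foldl_consE map_id cats0.
apply: (run_fold2 (E := fun acc => vlist [seq Z x | x <- acc]) r1 r2) => [|t x]; run_steps.
exact: ra.
Qed.

Lemma run_iota n e k : run n e (VNat k) -> run (PIota n) e (vnats (iota 0 k)).
Proof.
move=> rn; suff loop m s : run (PWhile (PVar 0)
    (PCons (PBin PSub (PVar 0) (PNat 1))
      (PCons (PBin PSub (PVar 0) (PNat 1)) (PUp 1 PId))))
    (VCons (VNat m) (vnats s)) (VCons (VNat 0) (vnats (iota 0 m ++ s))).
  by apply: run_seq (run_seq (loop k [::]) _); rewrite ?cats0; run_steps.
elim: m s => [|m ih] s; first by apply: run_while_stop; run_steps.
have -> : iota 0 m.+1 ++ s = iota 0 m ++ m :: s by rewrite -addn1 iotaD -catA.
by apply: run_while_step (ih _); run_steps;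
  (apply: run_eq; [run_steps|rewrite subSS subn0]).
Qed.

Lemma run_iter (T : Type) (E : T -> val_of K) (F : T -> T) n i s e k t :
  run n e (VNat k) -> run i e (E t) ->
  (forall t, run s (VCons (E t) e) (E (F t))) ->
  run (PIter n i s) e (E (iter k F t)).
Proof.
move=> rn ri rs; have -> : iter k F t = foldl (fun t _ => F t) t (iota 0 k).
  elim: k t {rn ri} => // k ih t; rewrite -[k.+1]addn1 iotaD foldl_cat -ih.
  by rewrite addn1.
apply: (run_fold (X := VNat) (E := E)) (run_iota rn) ri _ => t' x.
by run_steps; apply: rs.
Qed.

(** Two tuples become images of one list of indices, the form in which [run_fold2] takes two
    lists. *)
Lemma vnats_tuple r (a : r.-tuple nat) :
  vnats a = vlist [seq VNat (nth 0%N a i) | i <- iota 0 r].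
Proof.
by rewrite (map_comp VNat) map_nth_iota0 ?size_tuple// take_oversize ?size_tuple.
Qed.

Lemma foldl_sum (V : nmodType) (I : Type) (F : I -> V) (s : seq I) (t : V) :
  foldl (fun t i => t + F i) t s = t + \sum_(i <- s) F i.
Proof.
by elim: s t => [|i s ih] t /=; rewrite ?big_nil ?addr0// big_cons ih addrA.
Qed.

Lemma run_eq_nats r (a b : r.-tuple nat) l1 l2 e :
  run l1 e (vnats a) -> run l2 e (vnats b) ->
  run (PEqNats l1 l2) e (VNat (a == b)).
Proof.
rewrite !vnats_tuple => r1 r2.
pose F t i := (t + ((nth 0 a i - nth 0 b i) + (nth 0 b i - nth 0 a i)))%N.
pose n := foldl F 0%N (iota 0 r).
have rn : run (PFold2 l1 l2 (PNat 0) (PBin PAdd (PVar 2)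
        (PBin PAdd (PBin PSub (PVar 0) (PVar 1)) (PBin PSub (PVar 1) (PVar 0))))) e (VNat n).
  by apply: (run_fold2 (E := VNat) r1 r2) => [|t i]; run_steps.
have nE : (n == 0)%N = (a == b).
  rewrite /n (foldl_sum (V := nat)) add0r sum_nat_seq_eq0; apply/allP/eqP => [ab|-> i _].
    apply: eq_from_tnth => i; have := ab i; rewrite mem_iota ltn_ord => /(_ isT) /=.
    by rewrite !(tnth_nth 0%N); lia.
  by rewrite subnn.
rewrite -nE; case: n rn {nE} => [|n] rn.
  by apply: run_if_false rn _; run_steps.
by apply: run_if_true rn _; run_steps.
Qed.

Lemma run_add_nats r (a b : r.-tuple nat) l1 l2 e :
  run l1 e (vnats a) -> run l2 e (vnats b) ->
  run (PAddNats l1 l2) e (vnats (tadd a b)).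
Proof.
rewrite !vnats_tuple => r1 r2.
have -> : [seq VNat (nth 0 (tadd a b) i) | i <- iota 0 r] =
    [seq (VNat (nth 0 a i + nth 0 b i) : val_of K) | i <- iota 0 r].
  apply/eq_in_map => i; rewrite mem_iota => /andP[_ ir].
  by rewrite (nth_mktuple _ _ (Ordinal ir)) !(tnth_nth 0%N).
by apply: run_map2 r1 r2 _ => i; run_steps.
Qed.

Lemma run_dot r (w : nat -> nat) (a : r.-tuple nat) l1 l2 e :
  run l1 e (vnats (mkseq w r)) -> run l2 e (vnats a) ->
  run (PDot l1 l2) e (VNat (\sum_(i < r) w i * nth 0 a i)).
Proof.
rewrite vnats_tuple /Defs.vnats /mkseq -map_comp => r1 r2.
have -> : (\sum_(i < r) w i * nth 0 a i)%N =
    foldl (fun t i => t + w i * nth 0 a i)%N 0%N (iota 0 r).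
  rewrite (foldl_sum (V := nat) (fun i => w i * nth 0 a i)%N) add0r.
  by rewrite -[r in iota 0 r]subn0 -/(index_iota 0 r) big_mkord.
by apply: (run_fold2 (E := VNat) r1 r2) => [|t i]; run_steps.
Qed.

End Programs.

(** * Programs for weights, sparse polynomials and elimination *)

Definition PWeights (q b : prog) : prog :=
  PTail (PFold2 (PRev q) (PRev (PTail b)) (PCons (PNat 1) (PCons (PNat 1) PNil))
    (PLet (PBin PMul (PBin PAdd (PVar 1) (PNat 1)) (PHead (PVar 2)))
      (PCons (PBin PAdd (PBin PMul (PVar 1) (PHead (PVar 3))) (PVar 0))
        (PCons (PVar 0) (PTail (PVar 3)))))).

Definition PXzeta (p q m : prog) : prog :=
  PRev (PTail (PFold2 m (PCons (PNat 0) q) (PCons (PNat 0) PNil)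
    (PLet (PBin PAdd (PBin PMul (PUp 3 p) (PVar 0)) (PBin PMul (PVar 1) (PHead (PVar 2))))
      (PCons (PVar 0) (PCons (PVar 0) (PTail (PVar 3))))))).

Definition PPolyMul (l1 l2 : prog) : prog :=
  PFold l1 PNil (PFold (PUp 2 l2) (PVar 1)
    (PCons (PCons (PAddNats (PHead (PVar 2)) (PHead (PVar 0)))
      (PBin PEltMul (PTail (PVar 2)) (PTail (PVar 0)))) (PVar 1))).

Definition PPolyCoef (l m : prog) : prog :=
  PFold l PElt0 (PBin PEltAdd (PVar 1)
    (PIf (PEqNats (PHead (PVar 0)) (PUp 2 m)) (PTail (PVar 0)) PElt0)).

Definition PXfg (p q d tf tg i j : prog) : prog :=
  PIter (PBin PSub d j)
    (PIter j (PCons (PCons (PXzeta p q i) PElt1) PNil) (PPolyMul (PUp 1 tf) (PVar 0)))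
    (PPolyMul (PUp 1 tg) (PVar 0)).

(** Total, with value 0 at 0 as for the inverse of a field, so that [run_reduce] holds for any
    pivot. *)
Definition PInv0 (a : prog) : prog :=
  PSeq a (PIf PEltIs0 PElt0 PEltInv).

Definition PReduce (v p : prog) : prog :=
  PLet (PBin PEltMul (PHead v) (PInv0 (PHead p)))
    (PMap2 (PUp 1 (PTail v)) (PUp 1 (PTail p))
      (PBin PEltAdd (PVar 0) (PSeq (PBin PEltMul (PVar 2) (PVar 1)) PEltOpp))).

(** The head of a row is its value under the current condition. It vanishes on the rows that are
    kept, and the column is dropped. *)
Definition PElim (rows : prog) : prog :=
  PTail (PFold rows (PCons PNil PNil)
    (PIf (PSeq (PHead (PVar 1)) PIsNil)
      (PIf (PSeq (PHead (PVar 0)) PEltIs0)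
        (PCons PNil (PCons (PTail (PVar 0)) (PTail (PVar 1))))
        (PCons (PVar 0) (PTail (PVar 1))))
      (PCons (PHead (PVar 1))
        (PCons (PReduce (PVar 0) (PHead (PVar 1))) (PTail (PVar 1)))))).

Section AlgorithmParts.
Variables (K : fieldType) (ask : nat -> val_of K).
Implicit Types e u v w : val_of K.
Local Notation run := (@run K ask).
Local Notation vlist := (@vlist K).
Local Notation vnats := (@vnats K).

Lemma run_weights r (q : r.-1.-tuple nat) (b : r.-tuple nat) lq lb e : (0 < r)%N ->
  run lq e (vnats q) -> run lb e (vnats b) ->
  run (PWeights lq lb) e (vnats (mkseq (zweight q b) r)).
Proof.
move=> r0 rq rb; pose F t i :=
  (let w := (nth 0 b i.+1 + 1) * t.1 in (nth 0 q i * t.1 + w, w :: t.2))%N.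
(* The weights are computed from the last variable backwards: the state holds the weight of the
   current x and the weights of all zeta from there on. *)
have foldF n m : (m + n = r.-1)%N ->
    foldl F (1%N, [:: 1%N]) (rev (iota m n)) =
    (xweight q b m, map (zweight q b) (iota m n.+1)).
  elim: n m => [|n ih] m mn /=.
    have -> : m = r.-1 by rewrite -mn addn0.
    by rewrite xweight_last /zweight prednK// ltnn.
  rewrite rev_cons foldl_rcons ih; last by lia.
  have mr : (m.+1 < r)%N by lia.
  by rewrite /F /= [X in (_, X :: _)](_ : _ = zweight q b m) ?/zweight ?mr ?addn1//
    (xweightS _ _ mr) mulnDl.
pose E (t : nat * seq nat) := VCons (VNat t.1) (vnats t.2).
have -> : mkseq (zweight q b) r = (foldl F (1%N, [:: 1%N]) (rev (iota 0 r.-1))).2.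
  by rewrite foldF// prednK.
apply: (run_seq (v := E (foldl F (1%N, [:: 1%N]) (rev (iota 0 r.-1))))); last exact: run_cdr.
have rq' : run (PRev lq) e (vlist [seq VNat (nth 0%N q i) | i <- rev (iota 0 r.-1)]).
  by apply: run_rev; rewrite -vnats_tuple.
have rb' : run (PRev (PTail lb)) e
    (vlist [seq VNat (nth 0%N b i.+1) | i <- rev (iota 0 r.-1)]).
  apply: run_rev; apply: run_seq; first exact: rb.
  rewrite vnats_tuple -[r in iota 0 r](prednK r0) /= -[iota 1 _]/(iota (1 + 0) _) iotaDl -map_comp.
  exact: run_cdr.
by apply: (run_fold2 (E := E) rq' rb') => [|t i]; run_steps.
Qed.

Lemma run_xzeta r (q : r.-1.-tuple nat) (m : r.-tuple nat) p lp lq lm e : (0 < r)%N ->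
  run lp e (VNat p) -> run lq e (vnats q) -> run lm e (vnats m) ->
  run (PXzeta lp lq lm) e (vnats (xzeta_tuple q p m)).
Proof.
move=> r0 rp rq rm; pose qq i := if i is j.+1 then nth 0%N q j else 0%N.
pose F t i := (let n := p * nth 0 m i + qq i * t.1 in (n, n :: t.2))%N.
have foldF k : foldl F (0%N, [::]) (iota 0 k) =
    (if k is j.+1 then xzeta q p m j else 0%N, rev (mkseq (xzeta q p m) k)).
  elim: k => // k ih; rewrite -addn1 iotaD foldl_cat ih addn1 mkseqS rev_rcons /=.
  by rewrite /F add0n /=; case: k {ih}.
have -> : vnats (xzeta_tuple q p m) =
    vlist [seq VNat i | i <- rev (foldl F (0%N, [::]) (iota 0 r)).2].
  by rewrite foldF /= revK /mkseq -val_enum_ord -(map_comp (xzeta q p m)).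
pose E (t : nat * seq nat) := VCons (VNat t.1) (vnats t.2).
apply: run_rev; apply: (run_seq (v := E (foldl F (0%N, [::]) (iota 0 r)))); last exact: run_cdr.
have rq' : run (PCons (PNat 0) lq) e (vlist [seq VNat (qq i) | i <- iota 0 r]).
  rewrite -[r in iota 0 r](prednK r0) /= -[iota 1 _]/(iota (1 + 0) _) iotaDl -map_comp.
  by apply: run_cons; [apply: run_nat|rewrite -vnats_tuple].
rewrite vnats_tuple in rm.
by apply: (run_fold2 (E := E) rm rq') => [|t i]; run_steps; apply: rp.
Qed.

Definition vterm r (x : r.-tuple nat * K) : val_of K := VCons (vnats x.1) (VElt x.2).

Lemma run_poly_mul r (l1 l2 : seq (r.-tuple nat * K)) p1 p2 e :
  run p1 e (vlist (map (@vterm r) l1)) -> run p2 e (vlist (map (@vterm r) l2)) ->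
  run (PPolyMul p1 p2) e (vlist (map (@vterm r) (pmul l1 l2))).
Proof.
move=> r1 r2; pose E (l : seq (r.-tuple nat * K)) := vlist (map (@vterm r) l).
apply: (run_fold (E := E) r1) => [|acc x]; first by run_steps.
apply: (run_fold (X := @vterm r) (E := E)) => [||acc' y]; try by run_steps.
by run_steps; apply: run_add_nats; run_steps.
Qed.

Lemma run_poly_coef r (l : seq (r.-tuple nat * K)) (m : r.-tuple nat) pl pm e :
  run pl e (vlist (map (@vterm r) l)) -> run pm e (vnats m) ->
  run (PPolyCoef pl pm) e (VElt (pcoef l m)).
Proof.
move=> rl rm; apply: (run_fold (E := @VElt K) rl) => [|acc x]; first by run_steps.
apply: (run_seq (v := VCons (VElt acc) (VElt (if x.1 == m then x.2 else 0)))); last by run_steps.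
apply: run_cons; first by run_steps.
apply: (run_if (b := x.1 == m)) => [|->|/negbTE->].
- by apply: run_eq_nats; run_steps.
- by run_steps.
- by run_steps.
Qed.

Lemma run_xfg r (q : r.-1.-tuple nat) (p d : nat) (tf tg : seq (r.-tuple nat * K))
    (i : r.-tuple nat) j lp lq ld ltf ltg li lj e : (0 < r)%N ->
  run lp e (VNat p) -> run lq e (vnats q) -> run ld e (VNat d) ->
  run ltf e (vlist (map (@vterm r) tf)) -> run ltg e (vlist (map (@vterm r) tg)) ->
  run li e (vnats i) -> run lj e (VNat j) ->
  run (PXfg lp lq ld ltf ltg li lj) e
    (vlist (map (@vterm r) (xfg d p q tf tg i j))).
Proof.
move=> r0 rp rq rd rf rg ri rj.
pose E (l : seq (r.-tuple nat * K)) := vlist (map (@vterm r) l).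
apply: (run_iter (E := E)) => [||l].
- by run_steps; eassumption.
- apply: (run_iter (E := E)) => [||l]; first exact: rj.
    by run_steps; apply: run_xzeta.
  by apply: run_poly_mul; run_steps.
- by apply: run_poly_mul; run_steps.
Qed.

Section Rows.
Variables (I : Type) (V : vectType K) (phi : I -> {linear V -> K^o}).

(** A vector is known to the program only through its values under a list of linear forms. Reduction
    being linear, it acts on these values entry by entry. *)
Definition vrow (cs : seq I) (v : V) : val_of K :=
  vlist [seq VElt (phi c v : K) | c <- cs].

Lemma run_inv0 a e (x : K) : run a e (VElt x) -> run (PInv0 a) e (VElt x^-1).
Proof.
move=> ra; apply: run_seq ra _; apply: (run_if (b := x == 0)).
- exact: run_eltis0.
- by move=> /eqP ->; rewrite invr0; apply: run_elt0.
- by move=> x0; apply: run_eltinv.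
Qed.

Lemma run_reduce c cs (v p : V) pv pp e :
  run pv e (vrow (c :: cs) v) -> run pp e (vrow (c :: cs) p) ->
  run (PReduce pv pp) e (vrow cs (reduce (phi c) p v)).
Proof.
move=> rv rp; apply: (run_let (v := VElt (phi c v / phi c p : K))).
  apply: (run_seq (v := VCons (VElt (phi c v : K)) (VElt (phi c p : K)^-1)));
    last exact: run_eltmul.
  apply: run_cons; first by apply: run_seq rv _; apply: run_car.
  by apply: run_inv0; apply: run_seq rp _; apply: run_car.
apply: (run_map2 (X := fun c => VElt (phi c v : K)) (Y := fun c => VElt (phi c p : K))).
- by run_steps; [apply: rv|apply: run_cdr].
- by run_steps; [apply: rp|apply: run_cdr].
move=> c'; run_steps.
by apply: run_eq; [run_steps|rewrite /reduce linearB linearZ].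
Qed.

Lemma run_elim c cs (R : seq V) pR e :
  run pR e (vlist (map (vrow (c :: cs)) R)) ->
  run (PElim pR) e (vlist (map (vrow cs) (elim_rows (phi c) R))).
Proof.
move=> rR; pose E (st : seq V * seq V) :=
  VCons (if st.1 is p :: _ then vrow (c :: cs) p else VNil)
    (vlist (map (vrow cs) st.2)).
apply: (run_seq (v := E (foldl (elim_step (phi c)) ([::], [::]) R))); last exact: run_cdr.
apply: (run_fold (E := E) rR) => [|[[|p ps] out] v]; first by run_steps.
  apply: run_if_true; first by run_steps; apply: run_isnil_nil.
  rewrite /elim_step /=; apply: (run_if (b := phi c v == 0)) => [|->|/negbTE->].
  - by run_steps.
  - by run_steps.
  - by run_steps.
apply: run_if_false; first by run_steps; apply: run_isnil_cons.
run_steps; apply: run_reduce; by run_steps.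
Qed.

End Rows.

End AlgorithmParts.

(** * The complete program *)

Definition PSmallKeys (ks weights bound : prog) : prog :=
  PFold ks PNil (PIf (PBin PSub (PUp 2 bound) (PDot (PUp 2 weights) (PVar 0)))
    (PCons (PVar 0) (PVar 1)) (PVar 1)).

Definition PIndices (ks d : prog) : prog :=
  PFold ks PNil (PFold (PIota (PBin PAdd (PUp 2 d) (PNat 1))) (PVar 1)
    (PCons (PCons (PVar 2) (PVar 0)) (PVar 1))).

Definition PDelta (u v : prog) : prog :=
  PIf (PEqNats (PHead u) (PHead v))
    (PIf (PBin PAdd (PBin PSub (PTail u) (PTail v)) (PBin PSub (PTail v) (PTail u)))
      PElt0 PElt1)
    PElt0.

Definition PRow (p q d tf tg ms us u : prog) : prog :=
  PLet (PXfg p q d tf tg (PHead u) (PTail u))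
    (PFold (PUp 1 ms) (PMap (PUp 1 us) (PDelta (PUp 2 u) (PVar 0)))
      (PCons (PPolyCoef (PVar 2) (PVar 0)) (PVar 1))).

(* The variables are bound in the order beta, weights, bound, N, answer of the
   procedure, keys, small keys, indices, rows, kernel basis. *)
Definition PMain : prog :=
  PLet (PAddNats (PVar 5) (PVar 6))
 (PLet (PWeights (PVar 4) (PVar 0))
 (PLet (PBin PAdd (PVar 6) (PBin PMul (PVar 2) (PDot (PVar 0) (PVar 8))))
 (PLet (PBin PAdd (PVar 4) (PVar 0))
 (PLet (PSeq (PVar 0) PAsk)
 (PLet (PMap (PHead (PVar 0)) (PHead (PVar 0)))
 (PLet (PSmallKeys (PVar 0) (PVar 4) (PVar 3))
 (PLet (PIndices (PVar 1) (PVar 7))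
 (PLet (PMap (PVar 0) (PRow (PVar 11) (PVar 12) (PVar 9) (PHead (PVar 4))
          (PTail (PVar 4)) (PVar 2) (PVar 1) (PVar 0)))
 (PLet (PFold (PRev (PVar 2)) (PVar 0) (PElim (PVar 1)))
   (PCons (PVar 6)
     (PMap (PVar 0) (PMap2 (PVar 3) (PVar 0) (PCons (PVar 0) (PVar 1)))))))))))))).

Section MainParts.
Variables (K : fieldType) (ask : nat -> val_of K) (r d N : nat).
Local Notation run := (@run K ask).
Local Notation vlist := (@vlist K).
Local Notation vnats := (@vnats K).
Local Notation V := {ffun index_set r d N -> K^o}.
Implicit Types (m : r.-tuple nat) (u : index_set r d N).

Definition vpair (x : r.-tuple nat * nat) : val_of K := VCons (vnats x.1) (VNat x.2).

Definition ipair u : r.-tuple nat * nat := (index_x u, index_y u).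

Lemma ipair_inj : injective ipair.
Proof. by move=> u v [xuv yuv]; apply: index_inj => //; apply: val_inj. Qed.

Lemma run_small_keys q b bd (ms : seq (r.-tuple nat)) lks lw lb e : 
  run lks e (vlist [seq vnats m | m <- ms]) ->
  run lw e (vnats (mkseq (@zweight r q b) r)) -> run lb e (VNat bd) ->
  run (PSmallKeys lks lw lb) e
    (vlist [seq vnats m | m <- rev [seq m <- ms | zwt q b m < bd]%N]).
Proof.
move=> rk rw rb.
have -> : rev [seq m <- ms | zwt q b m < bd]%N =
    foldl (fun acc m => if (zwt q b m < bd)%N then m :: acc else acc) [::] ms.
  rewrite -[LHS]cats0; elim: ms [::] {rk} => //= m ms ih acc; rewrite -ih.
  by case: ifP => // _; rewrite rev_cons cat_rcons.
pose E (l : seq (r.-tuple nat)) := vlist [seq vnats m | m <- l].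
apply: (run_fold (E := E) rk) => [|acc m]; first exact: run_nil.
(* Truncated subtraction doubles as a test: the result is nonzero exactly when the weight is below
   the bound. *)
have rsub : run (PBin PSub (PUp 2 lb) (PDot (PUp 2 lw) (PVar 0)))
    (VCons (vnats m) (VCons (E acc) e)) (VNat (bd - zwt q b m)).
  apply: run_seq; last exact: run_sub.
  by apply: run_cons; [|apply: run_dot]; run_steps; eassumption.
have [bm|bm] := ltnP (zwt q b m) bd.
  rewrite -subn_gt0 in bm; rewrite -(prednK bm) in rsub.
  by apply: run_if_true rsub _; run_steps.
rewrite -subn_eq0 in bm; rewrite (eqP bm) in rsub.
by apply: run_if_false rsub _; run_steps.
Qed.

Lemma run_indices (ms : seq (r.-tuple nat)) lks ld e :
  run lks e (vlist [seq vnats m | m <- ms]) -> run ld e (VNat d) ->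
  run (PIndices lks ld) e
    (vlist [seq vpair x | x <- rev [seq (m, j) | m <- ms, j <- iota 0 d.+1]]).
Proof.
move=> rk rd.
have -> : rev [seq (m, j) | m <- ms, j <- iota 0 d.+1] =
    foldl (fun acc m => foldl (fun acc j => (m, j) :: acc) acc (iota 0 d.+1)) [::] ms.
  rewrite -[LHS]cats0; elim: ms [::] {rk} => // m ms ih acc.
  by rewrite allpairs_cons rev_cat -catA ih -foldl_consE.
pose E l := vlist [seq vpair x | x <- l].
apply: (run_fold (E := E) rk) => [|acc m]; first exact: run_nil.
apply: (run_fold (X := VNat) (E := E)) => [||acc' j].
- rewrite -[Defs.vlist _]/(vnats (iota 0 d.+1)); apply: run_iota.
  by rewrite -[d.+1]addn1; run_steps; exact: rd.
- by run_steps.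
- by run_steps.
Qed.

Lemma run_delta u v lu lv e :
  run lu e (vpair (ipair u)) -> run lv e (vpair (ipair v)) ->
  run (PDelta lu lv) e (VElt ((v == u)%:R : K)).
Proof.
move=> ru rv; apply: (run_if (b := index_x u == index_x v)).
- apply: run_eq_nats.
    by apply: run_seq ru _; apply: run_car.
  by apply: run_seq rv _; apply: run_car.
- move=> /eqP uvx; set n := ((index_y u - index_y v) + (index_y v - index_y u))%N.
  have rn : run (PBin PAdd (PBin PSub (PTail lu) (PTail lv))
      (PBin PSub (PTail lv) (PTail lu))) e (VNat n).
    by run_steps; first [exact: ru | exact: rv | exact: run_cdr].
  have [vu|vu] := eqVneq v u.
    have n0 : n = 0%N by rewrite /n vu subnn.
    by rewrite n0 in rn; apply: run_if_false rn _; apply: run_elt1.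
  have n0 : (0 < n)%N.
    by rewrite lt0n; apply: contra vu => n0; apply/eqP/index_inj => //; lia.
  by rewrite -(prednK n0) in rn; apply: run_if_true rn _; apply: run_elt0.
- move=> uv; rewrite (_ : v == u = false); first exact: run_elt0.
  by apply: contraNF uv => /eqP->.
Qed.

Definition delta_ffun u : V := [ffun v => (v == u)%:R].

Variables (p : nat) (q : r.-1.-tuple nat) (tf tg : seq (r.-tuple nat * K)).

Definition row_form (c : r.-tuple nat + index_set r d N) : {linear V -> K^o} :=
  match c with
  | inl m => lincond p q tf tg m
  | inr u => coordinate u
  end.

Lemma lincond_delta m u :
  lincond p q tf tg m (delta_ffun u) = pcoef (xfg d p q tf tg (index_x u) (index_y u)) m.
Proof.
rewrite /lincond (bigD1 u)//= ffunE eqxx mul1r big1 ?addr0// => v /negbTE vu.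
by rewrite ffunE vu mul0r.
Qed.

Lemma run_row (ms : seq (r.-tuple nat)) (us : seq (index_set r d N)) u
    lp lq ld ltf ltg lms lus lu e : (0 < r)%N ->
  run lp e (VNat p) -> run lq e (vnats q) -> run ld e (VNat d) ->
  run ltf e (vlist (map (@vterm K r) tf)) -> run ltg e (vlist (map (@vterm K r) tg)) ->
  run lms e (vlist [seq vnats m | m <- ms]) ->
  run lus e (vlist [seq vpair (ipair u) | u <- us]) ->
  run lu e (vpair (ipair u)) ->
  run (PRow lp lq ld ltf ltg lms lus lu) e
    (vrow row_form (map inl (rev ms) ++ map inr us) (delta_ffun u)).
Proof.
move=> r0 rp rq rd rf rg rms rus ru; pose l := xfg d p q tf tg (index_x u) (index_y u).
apply: (run_let (v := vlist (map (@vterm K r) l))).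
  by apply: run_xfg => //; apply: run_seq ru _; [apply: run_car|apply: run_cdr].
have -> : vrow row_form (map inl (rev ms) ++ map inr us) (delta_ffun u) =
    vlist (map (@VElt K) (foldl (fun acc m => pcoef l m :: acc)
      [seq (v == u)%:R | v <- us] ms)).
  rewrite foldl_consE /vrow !map_cat -map_rev -!map_comp; congr (vlist (_ ++ _)).
    by apply: eq_map => m /=; rewrite lincond_delta.
  by apply: eq_map => v /=; rewrite /coordinate ffunE.
apply: (run_fold (X := fun m : r.-tuple nat => vnats m)
  (E := fun acc => vlist (map (@VElt K) acc))).
- by run_steps; exact: rms.
- rewrite -map_comp; apply: (run_map (X := vpair \o ipair)).
    by run_steps; exact: rus.
  by move=> v; apply: run_delta; run_steps; exact: ru.
- move=> acc m; apply: run_cons; last by run_steps.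
  by apply: run_poly_coef; run_steps.
Qed.

End MainParts.

Lemma run_main (K : fieldType) (ask : nat -> val_of K) r d nu0 p (q : r.-1.-tuple nat)
    (valf valg : r.-tuple nat) nu (tf tg : seq (r.-tuple nat * K)) :
  let b := tadd valf valg in let bd := bound d q valf valg nu in
  let N := (nu0 + bd)%N in
  let ms := [seq m <- map fst tf | (zwt q b m < bd)%N] in
  forall us : seq (index_set r d N), (0 < r)%N ->
  ask N = VCons (vlist (map (@vterm K r) tf)) (vlist (map (@vterm K r) tg)) ->
  map (@ipair r d N) us = rev [seq (m, j) | m <- map fst tf, j <- iota 0 d.+1] ->
  run ask PMain (input_data K d nu0 p q nu valf valg)
    (VCons (VNat N) (vlist [seq
      vlist [seq VCons (vpair K (ipair u)) (VElt (v u : K)) | u <- us]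
      | v : {ffun index_set r d N -> K^o} <-
          foldl (fun R m => elim_rows (row_form p q tf tg (inl m)) R)
               [seq delta_ffun K u | u <- us] ms])).
Proof.
move=> b bd N ms us r0 askN usE.
apply: run_let; first by apply: run_add_nats; run_steps.
apply: run_let; first by apply: run_weights; run_steps.
apply: run_let.
  apply: run_seq; first apply: run_cons; first by run_steps.
    apply: run_seq; first apply: run_cons; first by run_steps.
      by apply: run_dot; run_steps.
    exact: run_mul.
  exact: run_add.
apply: run_let; first by run_steps.
apply: run_let; first by run_steps.
rewrite [X in ask X](_ : _ = N)// askN.
apply: (run_let (v := vlist [seq vnats K m | m : r.-tuple nat <- map fst tf])).
  rewrite -map_comp; apply: (run_map (X := @vterm K r)) => [|x]; by run_steps.
apply: (run_let (v := vlist [seq vnats K m | m : r.-tuple nat <- rev ms])).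
  by apply: run_small_keys; run_steps.
apply: (run_let (v := vlist [seq vpair K (ipair u) | u <- us])).
  by rewrite (map_comp (@vpair K r)) usE; apply: run_indices; run_steps.
pose cs := map inl (rev (rev ms)) ++ map inr us.
apply: (run_let (v := vlist (map (vrow (row_form p q tf tg) cs)
    [seq delta_ffun K u | u <- us]))).
  rewrite -(map_comp (vrow (row_form p q tf tg) cs)).
  apply: (run_map (X := @vpair K r \o @ipair r d N)).
    by run_steps.
  by move=> u; apply: run_row => //; run_steps.
set R := foldl _ _ _.
apply: (run_let (v := vlist (map (vrow (row_form p q tf tg) (map inr us)) R))).
  rewrite /cs revK.
  (* Rows carry the conditions still to come, then the coordinates, so that only coordinates are
     left at the end. The list of small keys is reversed to follow the order of the columns. *)
  apply: (run_fold_dep (X := fun m : r.-tuple nat => vnats K m)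
    (E := fun ms R => vlist (map (vrow (row_form p q tf tg) (map inl ms ++ map inr us)) R))).
  - have := @run_rev K ask _ (fun m : r.-tuple nat => vnats K m) _ _ (rev ms).
    by rewrite revK; apply; run_steps.
  - by run_steps.
  - move=> R' m ms'.
    by apply: (@run_elim K ask _ _ (row_form p q tf tg) (inl m)); run_steps.
apply: run_cons; first by run_steps.
apply: (run_map (X := vrow (row_form p q tf tg) (map inr us))) => [|v].
  by run_steps.
apply: (run_map2 (X := @vpair K r \o @ipair r d N) (Y := fun u => VElt (v u : K))).
- by run_steps.
- by rewrite /vrow -map_comp; run_steps.
- by move=> u; run_steps.
Qed.

(** * Correctness *)

Lemma span_theta (K : fieldType) (V : vectType K) (bs : seq V) v :
  (exists theta : 'I_(size bs) -> K, v = \sum_(m < size bs) theta m *: bs`_m) <->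
  v \in <<bs>>%VS.
Proof.
split=> [[theta ->]|vbs].
  by apply: memv_suml => m _; rewrite memvZ// memv_span// mem_nth.
by exists ((coord (in_tuple bs))^~ v); apply: (@coord_span _ _ _ (in_tuple bs)).
Qed.

(** Used to lift the pairs produced by the program to elements of [index_set], which carry proofs of
    their bounds. *)
Lemma ex_map_seq (I : Type) (J : eqType) (h : I -> J) (s : seq J) :
  (forall x, x \in s -> exists i, h i = x) -> exists t, map h t = s.
Proof.
elim: s => [|x s ih] hs; first by exists [::].
have [t <-] := ih (fun y ys => hs y (mem_behead (s := x :: s) ys)).
by have [i <-] := hs x (mem_head _ _); exists (i :: t).
Qed.

Lemma delta_ffun_free_span (K : fieldType) r d N (us : seq (index_set r d N)) :
  uniq us -> us =i predT ->
  free [seq delta_ffun K u | u <- us] /\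
  forall v, v \in <<[seq delta_ffun K u | u <- us]>>%VS.
Proof.
move=> uniq_us usT; split=> [|v].
  elim: us uniq_us {usT} => [|u us ih] /=; first by rewrite nil_free.
  move=> /andP[uus /ih free_us]; rewrite free_cons free_us andbT.
  apply/negP => u_span.
  have /span_subvP/subvP/(_ _ u_span) : {subset [seq delta_ffun K v | v <- us] <=
      lker (linfun (coordinate u : {linear {ffun index_set r d N -> K^o} -> K^o}))}.
    move=> _ /mapP[v vus ->]; rewrite memv_ker lfunE /= /coordinate ffunE.
    by rewrite (_ : u == v = false)//; apply: contraNF uus => /eqP->.
  by rewrite memv_ker lfunE /= /coordinate ffunE eqxx oner_eq0.
have -> : v = \sum_(u <- us) (v u : K) *: delta_ffun K u.
  apply/ffunP => w; rewrite sum_ffunE (bigD1_seq w) ?usT//= !ffunE eqxx [_ *: _]mulr1.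
  by rewrite big1 ?addr0// => u /negbTE uw; rewrite !ffunE eq_sym uw scaler0.
rewrite big_seq; apply: memv_suml => u uus.
by rewrite memvZ// memv_span// map_f.
Qed.

Theorem theorem1p1 :
  exists A : prog,
  forall (K : closedFieldType) (r d nu0 p : nat) (q : r.-1.-tuple nat)
    (f g : iter_laurent K r) (P : {poly iter_laurent K r})
    (valf valg beta : r.-tuple nat) (ask : nat -> val_of K),
  [pchar K] =i pred0 ->
  (2 <= r)%N -> (0 < d)%N -> (0 < p)%N ->
  in_Kzeta q f -> in_Kzeta q g -> f != 0 -> g != 0 ->
  in_Kx_y p P -> root P (f / g) -> (size P <= d.+1)%N ->
  xadic_order_le p nu0 P ->
  is_lexval q f valf -> is_lexval q g valg -> is_lexval q (f * g) beta ->
  coef_procedure q f g ask ->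
  forall nu : nat,
  exists (N : nat) (bs : seq {ffun index_set r d N -> K^o}) (out : val_of K),
    [/\ run ask A (input_data K d nu0 p q nu valf valg) out,
        output_data bs out &
        parametric_description nu0 p (Qset d nu0 p q beta (f / g) nu) bs].
Proof.
exists PMain => K r d nu0 p q f g P valf valg beta ask _ r2 _ p0 fz gz _ g0 _ _ _ _.
move=> f_val g_val fg_val askP nu.
have -> := lexvalM fz gz f_val g_val fg_val.
have r0 : (0 < r)%N by apply: leq_trans r2.
pose bd := bound d q valf valg nu; pose N := (nu0 + bd)%N.
(* The keys [sf] of the table of f enumerate, in whatever order they are returned, the conditions as
   well as the exponents of the index set. *)
have [vf [vg [askN [sf [uniq_sf sfP vfE]] [sg [uniq_sg sgP vgE]]]]] := askP N.
pose tf := table_of q sf f; pose tg := table_of q sg g.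
have tf1 : map fst tf = sf by rewrite -map_comp map_id.
have [us usE] : exists us : seq (index_set r d N),
    map (@ipair r d N) us = rev [seq (m, j) | m <- sf, j <- iota 0 d.+1].
  apply: ex_map_seq => x; rewrite mem_rev => /allpairsP[[m j] [ms js ->]].
  rewrite sfP inE in ms; rewrite mem_iota ltnS in js.
  by have [u [um uj]] := index_surj ms js; exists u; rewrite /ipair um uj.
have uniq_us : uniq us.
  rewrite -(map_inj_uniq (@ipair_inj r d N)) usE rev_uniq.
  by apply: allpairs_uniq => //; [apply: iota_uniq|move=> [? ?] [? ?] _ _ [-> ->]].
have usT : us =i predT.
  move=> u; rewrite -(mem_map (@ipair_inj r d N)) usE mem_rev; apply/allpairsP.
  exists (ipair u); split=> //; first by rewrite sfP inE sumn_index_x.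
  by rewrite mem_iota ltnS index_y_le.
have [free_delta span_delta] := delta_ffun_free_span K uniq_us usT.
pose ms := [seq m <- map fst tf | (zwt q (tadd valf valg) m < bd)%N].
have [freeR spanR] := elim_iter_free_span
  (fun m => @row_form K r d N p q tf tg (inl m)) ms free_delta.
have := @run_main K ask r d nu0 p q valf valg nu tf tg us r0.
rewrite -/bd -/N -/ms tf1 => /(_ _ usE) runE.
move: freeR spanR runE; set R := foldl _ _ _ => freeR spanR runE.
exists N, R; eexists; split.
- by apply: runE; rewrite askN vfE vgE /tf /tg /table_of -!map_comp.
- exists [seq vlist [seq VCons (vpair K (ipair u)) (VElt (v u : K)) | u <- us]
    | v : {ffun index_set r d N -> K^o} <- R].
  split=> // [|m mR]; first by rewrite size_map.
  by exists us; split=> //; rewrite (nth_map 0).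
split=> // [|Q Qx sQ]; first exact: leq_addr.
have cond := Qset_cond_lincond p0 fz gz g_val uniq_sf uniq_sg sfP sgP g0 Qx sQ.
(* The parameters account for the condition on the support, and [xadic_order_leP] for the one on the
   order. *)
have -> : (exists theta : 'I_(size R) -> K,
    [ffun u => xycoef p Q (index_x u) (index_y u)] = \sum_(m < size R) theta m *: R`_m) <->
    (forall n, scoef Q.[f / g] n != 0 -> nu%:Z <= Ltilde q (tadd valf valg) n).
  rewrite cond span_theta spanR; split=> [[_ lin] m msf mb|lin].
    by apply: lin; rewrite mem_filter tf1 mb.
  split=> [|m]; first exact: span_delta.
  by rewrite mem_filter tf1 => /andP[mb msf]; apply: lin.
rewrite -(xadic_order_leP p0 nu0 Qx).
by split=> [[]|[]].
Qed.
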